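(* Let $X$ be a separable infinite-dimensional complex Banach space. Then there exists a recurrent bounded operator $T$ on $X$ such that $\mathrm{Hr}(T)=\emptyset$ and the set of $q\in\mathrm{St}(T)$ such that $\overline{\mathfrak{L}(\omega)}$ has codimension $1$ in $X$ for every $\omega\in\mathfrak{C}$ with $q\in\mathfrak{L}(\omega)$ is dense in $X$.
   Context: For a bounded operator $T$ on $X$: $x$ is recurrent if $T^{\omega_n}x\to x$ for some strictly increasing sequence $(\omega_n)$ of positive integers; $\mathrm{Rec}(T)$ is the set of recurrent vectors and $T$ is recurrent if $\mathrm{Rec}(T)$ is dense. $\mathfrak{C}$ is the set of strictly increasing sequences $\omega$ of positive integers such that $T^{\omega_n}x\to x$ for some $x\ne 0$; $\mathfrak{L}(\omega)=\{x:T^{\omega_n}x\to x\}$. A sequence $\omega\in\mathfrak{C}$ is stationary if $\overline{\mathfrak{L}(\omega)}=\overline{\mathfrak{L}(\mu)}$ for every subsequence $\mu$ of $\omega$. $\mathrm{St}(T)$ is the set of $x\in\mathrm{Rec}(T)$ such that every $\omega\in\mathfrak{C}$ with $x\in\mathfrak{L}(\omega)$ is stationary. $\mathrm{Hr}(T)$ is the set of $x\in\mathrm{Rec}(T)$ such that $\mathfrak{L}(\omega)$ is dense in $X$ for every $\omega\in\mathfrak{C}$ with $x\in\mathfrak{L}(\omega)$. *)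

(* Defs.v *)
From HB Require Import structures.
From mathcomp Require Import all_boot all_order all_algebra.
From mathcomp Require Import all_classical all_reals all_analysis.
From mathcomp Require Import complex.
Set Implicit Arguments. Unset Strict Implicit. Unset Printing Implicit Defensive.
Import Order.TTheory GRing.Theory Num.Theory.
Import numFieldNormedType.Exports.
Local Open Scope classical_set_scope.
Local Open Scope ring_scope.

Section Defs.
Context {K : numFieldType} {X : normedModType K}.

Definition separable_space : Prop :=
  exists D : set X, countable D /\ closure D = setT.

Definition span_seq (s : seq X) : set X :=
  [set x | exists c : nat -> K, x = \sum_(i < size s) c i *: nth 0 s i].

Definition infinite_dimensional : Prop :=
  forall s : seq X, exists x : X, ~ span_seq s x.

Definition bounded_operator (T : X -> X) : Prop := linear T /\ continuous T.

Definition incr_pos (w : nat -> nat) : Prop :=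
  (forall m n, (m < n)%N -> (w m < w n)%N) /\ (forall n, (0 < w n)%N).

Definition Lset (T : X -> X) (w : nat -> nat) : set X :=
  [set x | (fun n => iter (w n) T x) @ \oo --> x].

Definition recurrent_vector (T : X -> X) (x : X) : Prop :=
  exists w, incr_pos w /\ Lset T w x.

Definition Rec (T : X -> X) : set X := [set x | recurrent_vector T x].

Definition recurrent (T : X -> X) : Prop := closure (Rec T) = setT.

Definition Cset (T : X -> X) : set (nat -> nat) :=
  [set w | incr_pos w /\ exists x, x <> 0 /\ Lset T w x].

Definition subsequence (mu w : nat -> nat) : Prop :=
  exists phi : nat -> nat, (forall m n, (m < n)%N -> (phi m < phi n)%N)
    /\ mu = w \o phi.

Definition stationary (T : X -> X) (w : nat -> nat) : Prop :=
  Cset T w /\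
  forall mu, subsequence mu w -> closure (Lset T w) = closure (Lset T mu).

Definition St (T : X -> X) : set X :=
  [set x | Rec T x /\
     forall w, Cset T w -> Lset T w x -> stationary T w].

Definition Hr (T : X -> X) : set X :=
  [set x | Rec T x /\
     forall w, Cset T w -> Lset T w x -> closure (Lset T w) = setT].

Definition codim1 (M : set X) : Prop :=
  exists v : X, ~ M v /\
    forall x : X, exists m : X, exists c : K, M m /\ x = m + c *: v.

End Defs.

(* Main.v *)
Require Import Defs.
From HB Require Import structures.
From mathcomp Require Import all_boot all_order all_algebra.
From mathcomp Require Import all_classical all_reals all_analysis.
From mathcomp Require Import complex.
From mathcomp Require Import ring lra zify.
Set Implicit Arguments. Unset Strict Implicit. Unset Printing Implicit Defensive.
Import Order.TTheory GRing.Theory Num.Theory.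
Import numFieldNormedType.Exports.
Local Open Scope classical_set_scope.
Local Open Scope ring_scope.

(** Let [e_j] be normalized vectors with linear functionals [f_j] biorthogonal to
them, and [u1], [u2] two more functionals vanishing on all [e_j], such that the
[e_j] span a dense subspace of [ker u1 `&` ker u2].  Put
  [T x = x + \sum_j h_j x e_j],
  [h_j = (lam_j - 1) f_j + (2 ^ b_j / m_j) w_j],
where [lam_j] is a primitive [m_(j+1)]-th root of unity with [|lam_j - 1| <= C / m_(j+1)],
the [m_j] are rapidly increasing powers of 2, [|f_j| <= 2 ^ b_j], and the [w_j]
are normalized combinations of [u1] and [u2] running densely through all
directions.  As [h_j e_i = 0] for [i <> j], the operator is triangular enough for
  [T ^ k x - x = \sum_j (1 + lam_j + ... + lam_j ^ (k - 1)) h_j x e_j].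
Along [k = m_n] all terms but the [n]-th are negligible and the [n]-th one has
size about [2 ^ b_n |w_n x|], so generic vectors are recurrent.  Conversely, if
[T ^ (k_n) q -> q] with [q] generic, every [m_j] divides [k_n] eventually, so that
all [e_j] return along [k_n]; and if [j] is the first index such that [m_(j+1)]
does not divide [k_n], the [j]-th term shows that [w_j x] is small for every
[x] with [T ^ (k_n) x -> x].  Since [w_j] is normalized, [(u1 x, u2 x)] is then
proportional to [(u1 q, u2 q)]: the closure of the set of these [x] is exactly
a hyperplane.  Letting the coupling grow like [2 ^ b_j] makes this work for
unbounded biorthogonal systems, which are obtained by a Gram-Schmidt argument
from the Hahn-Banach theorem. *)

(** * Real-valued norms, bounded functionals and sets with dense interior *)

Notation modc := (@Normc.normc _).

Lemma half_small {R : realType} (K e : R) : 0 < e ->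
  exists M, forall n, (M <= n)%N -> K * 2^-1 ^+ n < e.
Proof.
move=> e0; have q1 : `|2^-1 : R| < 1 by rewrite ger0_norm; lra.
have K0 : 0 < `|K| + 1 by rewrite ltr_wpDl.
have /cvgrPdist_lt/(_ _ (divr_gt0 e0 K0))[M _ hM] := cvg_expr q1.
exists M => n Mn; have := hM n Mn.
rewrite /= sub0r normrN ger0_norm ?exprn_ge0 ?invr_ge0 // ltr_pdivlMr // mulrC.
apply: le_lt_trans; rewrite ler_wpM2r ?exprn_ge0 ?invr_ge0 //.
by rewrite (le_trans (ler_norm K)) // lerDl.
Qed.

Section RealNorm.
Context {R : realType}.
Implicit Types c d : R[i].

Lemma modcE c : `|c| = (modc c)%:C%C.
Proof. by []. Qed.

Lemma modc_ge0 c : 0 <= modc c.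
Proof. by rewrite -lecR -modcE normr_ge0. Qed.

Lemma modcD c d : modc (c + d) <= modc c + modc d.
Proof. by rewrite -lecR rmorphD /= -!modcE ler_normD. Qed.

Lemma modcM c d : modc (c * d) = modc c * modc d.
Proof. by apply/complexI; rewrite rmorphM /= -!modcE normrM. Qed.

Lemma modcN c : modc (- c) = modc c.
Proof. by apply/complexI; rewrite -!modcE normrN. Qed.

Lemma modc0 : modc (0 : R[i]) = 0.
Proof. by apply/complexI; rewrite -!modcE normr0. Qed.

Lemma modc1 : modc (1 : R[i]) = 1.
Proof. by apply/complexI; rewrite -!modcE normr1. Qed.

Lemma modc_eq0 c : (modc c == 0) = (c == 0).
Proof. by rewrite -(inj_eq (@complexI R)) /= -modcE normr_eq0. Qed.

Lemma modcR (t : R) : modc t%:C%C = `|t|.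
Proof. by apply/complexI; rewrite -modcE normc_def /= expr0n /= addr0 sqrtr_sqr. Qed.

Context {X : normedModType R[i]}.
Implicit Types x y z : X.

(** The norm is valued in [R[i]]; its real part loses nothing and moves all estimates into the
    ordered field [R]. *)
Definition rnorm x : R := complex.Re `|x|.

Lemma rnormE x : `|x| = (rnorm x)%:C%C.
Proof. by rewrite /rnorm RRe_real // ger0_real. Qed.

Lemma rnorm_ge0 x : 0 <= rnorm x.
Proof. by rewrite -lecR -rnormE normr_ge0. Qed.

Lemma rnormD x y : rnorm (x + y) <= rnorm x + rnorm y.
Proof. by rewrite -lecR rmorphD /= -!rnormE ler_normD. Qed.

Lemma rnormN x : rnorm (- x) = rnorm x.
Proof. by apply/complexI; rewrite -!rnormE normrN. Qed.

Lemma rnormB x y : rnorm (x - y) <= rnorm x + rnorm y.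
Proof. by rewrite -(rnormN y) rnormD. Qed.

Lemma rdistC x y : rnorm (x - y) = rnorm (y - x).
Proof. by rewrite -rnormN opprB. Qed.

Lemma rdistD y x z : rnorm (x - z) <= rnorm (x - y) + rnorm (y - z).
Proof. by rewrite -[X in rnorm X <= _](subrKA y) rnormD. Qed.

Lemma rnormZ c x : rnorm (c *: x) = modc c * rnorm x.
Proof. by apply/complexI; rewrite rmorphM /= -modcE -!rnormE normrZ. Qed.

Lemma rnorm0 : rnorm (0 : X) = 0.
Proof. by apply/complexI; rewrite -!rnormE normr0. Qed.

Lemma rnorm_eq0 x : (rnorm x == 0) = (x == 0).
Proof. by rewrite -(inj_eq (@complexI R)) /= -rnormE normr_eq0. Qed.

Lemma rnorm_gt0 x : (0 < rnorm x) = (x != 0).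
Proof. by rewrite lt0r rnorm_ge0 andbT rnorm_eq0. Qed.

Lemma rnorm_small x : (forall e, 0 < e -> rnorm x <= e) -> x = 0.
Proof.
move=> h; apply/eqP; rewrite -rnorm_eq0; apply/eqP/le_anti.
by rewrite rnorm_ge0 andbT; apply/ler_addgt0Pl => e /h; rewrite addr0.
Qed.

Lemma posC_real (e : R[i]) : 0 < e -> 0 < complex.Re e /\ e = (complex.Re e)%:C%C.
Proof.
move=> e0; have ee : e = (complex.Re e)%:C%C by rewrite RRe_real // gtr0_real.
by split => //; move: e0; rewrite ee ltcR.
Qed.

Definition tends (u : nat -> X) x :=
  forall e : R, 0 < e -> exists M, forall n, (M <= n)%N -> rnorm (u n - x) < e.

Lemma tendsP u x : u @ \oo --> x <-> tends u x.
Proof.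
split => [/cvgrPdist_lt ux e e0|ux].
  have /ux [M _ hM] : 0 < e%:C%C :> R[i] by rewrite ltcR.
  by exists M => n Mn; move: (hM n Mn); rewrite rnormE ltcR rdistC.
apply/cvgrPdist_lt => e /posC_real[e0 ->]; have [M hM] := ux _ e0.
by exists M => // n /= Mn; rewrite rnormE ltcR rdistC hM.
Qed.

Lemma closure_rnormP (A : set X) x :
  closure A x <-> forall e, 0 < e -> exists y, A y /\ rnorm (y - x) < e.
Proof.
split => [cA e e0|h B /nbhs_ballP[e /= /posC_real[e0 ee] eB]].
  have /cA [y [Ay]] : nbhs x (ball x e%:C%C) by apply: nbhsx_ballx; rewrite ltcR.
  by rewrite -ball_normE /ball_ /= rnormE ltcR rdistC => xy; exists y.
have [y [Ay xy]] := h _ e0; exists y; split => //; apply: eB.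
by rewrite -ball_normE /ball_ /= rnormE ee ltcR rdistC.
Qed.

Lemma linear_bounded_cont (T : X -> X) (K : R) :
  linear T -> (forall x, rnorm (T x) <= K * rnorm x) -> continuous T.
Proof.
move=> lT bT x; apply/cvgrPdist_lt => e /posC_real[e0 ee].
have K0 : 0 < `|K| + 1 by rewrite ltr_wpDl.
apply/nbhs_ballP; exists (complex.Re e / (`|K| + 1))%:C%C => /=.
  by rewrite ltcR divr_gt0.
move=> y; rewrite -ball_normE /ball_ /= ee !rnormE !ltcR => xy.
have -> : T x - T y = T (x - y) by rewrite addrC -scaleN1r -lT scaleN1r addrC.
apply: (le_lt_trans (bT _)); rewrite ltr_pdivlMr // mulrC in xy.
apply: le_lt_trans xy; rewrite ler_wpM2r ?rnorm_ge0 //.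
by rewrite (le_trans (ler_norm K)) // lerDl.
Qed.

Definition functional (f : X -> R[i]) :=
  scalar f /\ exists K : R, forall x, modc (f x) <= K * rnorm x.

Section Functional.
Context (f : X -> R[i]) (ff : functional f).

Lemma functionalD x y : f (x + y) = f x + f y.
Proof. by have := ff.1 1 x y; rewrite scale1r mul1r. Qed.

Lemma functional0 : f 0 = 0.
Proof. by apply: (addIr (f 0)); rewrite -functionalD !add0r. Qed.

Lemma functionalZ c x : f (c *: x) = c * f x.
Proof. by have := ff.1 c x 0; rewrite functional0 !addr0. Qed.

Lemma functionalN x : f (- x) = - f x.
Proof. by rewrite -scaleN1r functionalZ mulN1r. Qed.

Lemma functionalB x y : f (x - y) = f x - f y.
Proof. by rewrite functionalD functionalN. Qed.

Lemma functional_sum n (F : nat -> X) : f (\sum_(i < n) F i) = \sum_(i < n) f (F i).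
Proof.
elim: n => [|n IH]; first by rewrite !big_ord0 functional0.
by rewrite !big_ord_recr /= functionalD IH.
Qed.

Lemma functional_bound : exists K : R, 0 < K /\ forall x, modc (f x) <= K * rnorm x.
Proof.
have [K hK] := ff.2; exists (`|K| + 1); split; first by rewrite ltr_wpDl.
move=> x; apply: (le_trans (hK x)); rewrite ler_wpM2r ?rnorm_ge0 //.
by rewrite (le_trans (ler_norm K)) // lerDl.
Qed.

(** The kernel of a bounded functional is closed: for [y] in it, [f x = - f (y - x)] is at most [K]
    times the distance. *)
Lemma functional_small (x : X) :
  (forall e, 0 < e -> exists y, f y = 0 /\ rnorm (y - x) < e) -> f x = 0.
Proof.
move=> h; have [K [K0 hK]] := functional_bound.
apply/eqP; rewrite -modc_eq0; apply/eqP/le_anti; rewrite modc_ge0 andbT.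
apply/ler_addgt0Pl => e e0; rewrite addr0.
have [y [fy xy]] := h (e / K) (divr_gt0 e0 K0).
have -> : f x = - f (y - x) by rewrite functionalB fy sub0r opprK.
rewrite modcN (le_trans (hK _)) // mulrC -ler_pdivlMr //; exact: ltW.
Qed.

End Functional.

Lemma functionalDZ f g c : functional f -> functional g ->
  functional (fun x => c * f x + g x).
Proof.
move=> ff fg; split => [a x y|].
  by rewrite (ff.1 a) (fg.1 a) /=; ring.
have [K [K0 hK]] := functional_bound ff; have [L [L0 hL]] := functional_bound fg.
exists (modc c * K + L) => x; rewrite mulrDl; apply: (le_trans (modcD _ _)).
by rewrite lerD // modcM -mulrA ler_wpM2l ?modc_ge0.
Qed.

Lemma functional_cst0 : functional (fun=> 0).
Proof.
by split => [a x y|]; [rewrite mulr0 addr0|exists 0 => x; rewrite modc0 mul0r].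
Qed.

Lemma functionalMl f c : functional f -> functional (fun x => c * f x).
Proof.
move=> ff; have := functionalDZ c ff functional_cst0.
by congr functional; apply/funext => x; rewrite addr0.
Qed.

Lemma closure_zero (phi : X -> R[i]) (A : set X) x : functional phi ->
  (forall y, A y -> phi y = 0) -> closure A x -> phi x = 0.
Proof.
move=> fphi A0 /closure_rnormP cx; apply: functional_small => // d /cx[y [Ay yx]].
by exists y; split => //; exact: A0.
Qed.

(** The interior of [F] is dense, phrased with balls as the nested-ball argument consumes it. *)
Definition dense_interior (F : X -> Prop) := forall x (d : R), 0 < d ->
  exists y (r : R), [/\ 0 < r, rnorm (y - x) < d & forall z, rnorm (z - y) < r -> F z].

Lemma dense_interior_and (F G : X -> Prop) :
  dense_interior F -> dense_interior G -> dense_interior (fun x => F x /\ G x).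
Proof.
move=> dF dG x d d0; have d2 : 0 < d / 2 by rewrite divr_gt0.
have [y [r [r0 yx Fz]]] := dF x _ d2.
have m0 : 0 < Num.min (d / 2) (r / 2) by rewrite lt_min d2 divr_gt0.
have [z [s [s0 zy Gz]]] := dG y _ m0; move: zy; rewrite lt_min => /andP[zy1 zy2].
exists z, (Num.min s (r / 2)); split; first by rewrite lt_min s0 divr_gt0.
  by have := rdistD y z x; lra.
move=> v; rewrite lt_min => /andP[vs vr]; split; last exact: Gz.
by apply: Fz; have := rdistD z v y; lra.
Qed.

(** A zero of [phi] is moved off the kernel by a small multiple of [v]; boundedness then keeps [phi]
    nonzero on a ball. *)
Lemma dense_interior_neq0 (phi : X -> R[i]) v : functional phi -> phi v != 0 ->
  dense_interior (fun x => phi x != 0).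
Proof.
move=> fphi pv x d d0; have [K [K0 hK]] := functional_bound fphi.
have [y [yx py]] : exists y, rnorm (y - x) < d /\ phi y != 0.
  have [px|px] := eqVneq (phi x) 0; last by exists x; rewrite subrr rnorm0.
  have c0 : 0 < d / (rnorm v + 1) by rewrite divr_gt0 // ltr_wpDl ?rnorm_ge0.
  exists (x + (d / (rnorm v + 1))%:C%C *: v); split.
    rewrite addrAC subrr add0r rnormZ modcR gtr0_norm // mulrAC ltr_pdivrMr.
      by rewrite ltr_pM2l // ltrDl.
    by rewrite ltr_wpDl ?rnorm_ge0.
  rewrite (functionalD fphi) (functionalZ fphi) px add0r mulf_neq0 //.
  by rewrite -modc_eq0 modcR normr_eq0 gt_eqF.
exists y, (modc (phi y) / K); split => //.
  by rewrite divr_gt0 // lt0r modc_eq0 py modc_ge0.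
move=> z; rewrite ltr_pdivlMr // mulrC => zy; apply/eqP => pz.
move: (le_lt_trans (hK _) zy).
by rewrite (functionalB fphi) pz sub0r modcN ltxx.
Qed.

End RealNorm.

(** * Completeness and the Baire category theorem *)

Section Complete.
Context {R : realType} {X : completeNormedModType R[i]}.
Implicit Types x y z : X.

Lemma rnorm_complete (u : nat -> X) :
  (forall e : R, 0 < e ->
     exists M, forall m n, (M <= m)%N -> (M <= n)%N -> rnorm (u m - u n) < e) ->
  exists l, tends u l.
Proof.
move=> cu; suff /cvg_ex [l ul] : cvg (u @ \oo) by exists l; apply/tendsP.
apply/cauchy_cvgP/cauchy_exP => e /posC_real[e0 ee]; have [M hM] := cu _ e0.
exists (u M), M => // n /= Mn.
by rewrite -ball_normE /ball_ /= rnormE ee ltcR hM.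
Qed.

Lemma geometric_limit (y : nat -> X) (d : nat -> R) :
  (forall n, 0 < d n) -> (forall n, d n.+1 <= d n / 2) ->
  (forall n, rnorm (y n.+1 - y n) <= d n / 2) ->
  exists l, forall n, rnorm (l - y n) <= d n.
Proof.
move=> d0 d2 yd.
(* Each step is at most [d n / 2], hence at most [d n - d n.+1], and these telescope. *)
have step n k : rnorm (y (n + k)%N - y n) <= d n - d (n + k)%N.
  elim: k => [|k IH]; first by rewrite addn0 !subrr rnorm0.
  rewrite addnS; apply: (le_trans (rdistD (y (n + k)%N) _ _)).
  by have := yd (n + k)%N; have := d2 (n + k)%N; lra.
have dn n : d n <= d 0%N * 2^-1 ^+ n.
  elim: n => [|n IH]; first by rewrite expr0 mulr1.
  by rewrite exprSr mulrA; apply: (le_trans (d2 n)); rewrite ler_wpM2r // invr_ge0.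
have [] := @rnorm_complete y.
  move=> e e0; have [M hM] : exists M, d M < e / 2.
    have [M hM] := half_small (d 0%N) (divr_gt0 e0 (@ltr0Sn R 1)).
    by exists M; apply: le_lt_trans (dn M) (hM M (leqnn M)).
  exists M => m n /subnKC <- /subnKC <-.
  apply: (le_lt_trans (rdistD (y M) _ _)).
  rewrite (rdistC (y M)).
  have := step M (m - M)%N; have := step M (n - M)%N.
  by have := d0 (M + (m - M))%N; have := d0 (M + (n - M))%N; lra.
move=> l yl; exists l => n; apply/ler_addgt0Pl => e e0.
have [M hM] := yl _ e0; have := hM (n + M)%N (leq_addl _ _).
have := step n M; have := d0 (n + M)%N.
by have := rdistD (y (n + M)%N) l (y n); rewrite (rdistC l (y (n + M)%N)); lra.
Qed.

Lemma rnorm_baire (F : nat -> X -> Prop) :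
  (forall i, dense_interior (F i)) ->
  forall x (e : R), 0 < e -> exists q, rnorm (q - x) < e /\ forall i, F i q.
Proof.
move=> dF x e e0.
(* The argument is an index with a ball, given as centre and radius. The conditional form makes the
   choice total; a nonpositive radius is returned unchanged. *)
have next (a : nat * (X * R)) : exists b : X * R, 0 < a.2.2 ->
    [/\ 0 < b.2, b.2 <= a.2.2 / 2, rnorm (b.1 - a.2.1) <= a.2.2 / 2 &
      forall z, rnorm (z - b.1) <= b.2 -> F a.1 z].
  case: (pselect (0 < a.2.2)) => [a0|?]; last by exists a.2.
  have a1 : 0 < a.2.2 / 2 by rewrite divr_gt0.
  have [y [d [d0 ya Fz]]] := dF a.1 a.2.1 _ a1.
  (* Halving [d] puts the closed ball inside the open one; halving the old radius gives geometric
     decay. *)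
  exists (y, Num.min (d / 2) (a.2.2 / 2)) => _; split => /=.
  - by rewrite lt_min a1 divr_gt0.
  - by rewrite ge_min lexx orbT.
  - exact: ltW.
  - by move=> z; rewrite le_min => /andP[zy _]; apply: Fz; lra.
have [g hg] := choice next.
pose s := fix s n := if n is k.+1 then g (k, s k) else (x, e / 2).
have s0 n : 0 < (s n).2.
  by elim: n => [|n IH] /=; [rewrite divr_gt0|case: (hg (n, s n) IH)].
have [||l hl] := @geometric_limit (fun n => (s n).1) (fun n => (s n).2) s0.
- by move=> n; case: (hg (n, s n) (s0 n)).
- by move=> n; case: (hg (n, s n) (s0 n)).
exists l; split => [|i]; first by apply: (le_lt_trans (hl 0%N)) => /=; lra.
by case: (hg (i, s i) (s0 i)) => _ _ _; apply; exact: (hl i.+1).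
Qed.

End Complete.

(** * The Hahn-Banach theorem *)

Section HahnBanach.
Context {R : realType} {X : normedModType R[i]}.
Implicit Types (x y z : X) (p q : X -> R).

Definition sublinear p :=
  (forall x y, p (x + y) <= p x + p y) /\
  (forall t x, 0 < t -> p (t%:C%C *: x) <= t * p x).

Lemma sublinear0 p : sublinear p -> p 0 = 0.
Proof.
move=> [pD pZ]; have := pD 0 0; have := pZ 2^-1 0; rewrite scaler0 addr0.
by move=> /(_ ltac:(by rewrite invr_gt0)) ? ?; lra.
Qed.

Lemma sublinearN p x : sublinear p -> - p (- x) <= p x.
Proof.
by move=> sp; have := sp.1 x (- x); rewrite subrr (sublinear0 sp); lra.
Qed.

(** The third hypothesis is a form of downward directedness, met by chains, that makes the pointwise
    infimum subadditive; the last one keeps the infimum finite. *)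
Lemma sublinear_inf (A : set (X -> R)) p0 : A p0 ->
  (forall p, A p -> sublinear p) ->
  (forall p q x y, A p -> A q ->
     exists2 r, A r & r (x + y) <= p x + q y) ->
  (forall x, exists b, forall p, A p -> b <= p x) ->
  exists p, sublinear p /\ (forall q x, A q -> p x <= q x).
Proof.
move=> Ap0 sA dA bA.
pose S x : set R := [set r | exists2 q, A q & r = q x].
have S0 x : S x !=set0 by exists (p0 x), p0.
have lbS x : has_lbound (S x).
  by have [b hb] := bA x; exists b => _ [q Aq ->]; exact: hb.
have infle q x : A q -> inf (S x) <= q x.
  by move=> Aq; apply: ge_inf => //; exists q.
exists (fun x => inf (S x)); split => //; split => [x y|t x t0].
  rewrite -lerBlDr; apply: lb_le_inf => // _ [q Aq ->].
  rewrite lerBlDr -lerBlDl; apply: lb_le_inf => // _ [r Ar ->].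
  rewrite lerBlDl; have [s As] := dA _ _ x y Aq Ar.
  exact: le_trans (infle _ _ As).
rewrite -ler_pdivrMl //; apply: lb_le_inf => // _ [q Aq ->].
rewrite ler_pdivrMl //; apply: le_trans (infle _ _ Aq) _.
exact: (sA _ Aq).2.
Qed.

(** Take for [q x] the infimum of [p (x + t y) - t p y] over [t >= 0]. The value [t = 0] gives
    [q <= p], and [t = 1] at [x = - y] gives the last bound. *)
Lemma sublinear_shift p y : sublinear p ->
  exists q, [/\ sublinear q, forall x, q x <= p x & q (- y) <= - p y].
Proof.
move=> sp.
pose S x : set R := [set r | exists2 t, 0 <= t & r = p (x + t%:C%C *: y) - t * p y].
have p1 t : 0 <= t -> p (t%:C%C *: y) <= t * p y.
  rewrite le_eqVlt => /predU1P[<-|/sp.2 //].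
  by rewrite mul0r scale0r sublinear0.
have p2 t : 0 <= t -> t * p y <= p (t%:C%C *: y).
  rewrite le_eqVlt => /predU1P[<-|t0]; first by rewrite mul0r scale0r sublinear0.
  rewrite -ler_pdivlMl //; apply: le_trans (sp.2 _ _ _); last by rewrite invr_gt0.
  by rewrite scalerA -rmorphM /= mulVf ?gt_eqF // scale1r.
have S0 x : S x !=set0 by exists (p (x + 0%:C%C *: y) - 0 * p y), 0.
have lbS x : has_lbound (S x).
  exists (- p (- x)) => _ [t t0 ->].
  have := sp.1 (x + t%:C%C *: y) (- x); rewrite addrAC subrr add0r.
  by have := p2 _ t0; lra.
have infle x t : 0 <= t -> inf (S x) <= p (x + t%:C%C *: y) - t * p y.
  by move=> t0; apply: ge_inf => //; exists t.
exists (fun x => inf (S x)); split => [|x|].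
- split => [x z|t x t0].
    rewrite -lerBlDr; apply: lb_le_inf => // _ [t t0 ->].
    rewrite lerBlDr -lerBlDl; apply: lb_le_inf => // _ [s s0 ->].
    rewrite lerBlDl; apply: le_trans (infle _ (s + t) _) _; first exact: addr_ge0.
    have := sp.1 (x + t%:C%C *: y) (z + s%:C%C *: y).
    by rewrite addrACA -scalerDl -rmorphD /= (addrC t); lra.
  rewrite -ler_pdivrMl //; apply: lb_le_inf => // _ [s s0 ->].
  rewrite ler_pdivrMl //; apply: le_trans (infle _ (t * s) _) _.
    by rewrite mulr_ge0 // ltW.
  rewrite mulrBr mulrA lerD2r; apply: le_trans (sp.2 _ _ t0).
  by rewrite scalerDr scalerA -rmorphM.
- by have := infle x 0 (lexx _); rewrite scale0r addr0 mul0r subr0.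
- by have := infle (- y) 1 ler01; rewrite scale1r addNr sublinear0 // mul1r sub0r.
Qed.

(* A minimal sublinear functional is linear: shifting it along [y] cannot make it smaller, which forces [p (- y) = - p y]. *)
Lemma sublinear_ge_linear p0 : sublinear p0 -> exists p,
  [/\ forall x y, p (x + y) = p x + p y, forall t x, p (t%:C%C *: x) = t * p x &
     forall x, p x <= p0 x].
Proof.
move=> sp0; pose T := {p | sublinear p /\ forall x, p x <= p0 x}.
(* The order is reversed, so that Zorn's maximal element is a pointwise minimal functional. *)
pose le (s t : T) := `[< forall x, sval t x <= sval s x >].
have t0 : T by exists p0.
have [||A totA|[p [sp pp0]] pmin] := @ZL_preorder T t0 le.
- by move=> t; apply/asboolP.
- move=> r s t /asboolP rs /asboolP st; apply/asboolP => x.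
  exact: le_trans (st x) (rs x).
(* The empty chain is bounded by [p0], a nonempty one by its pointwise infimum. *)
- have [[a Aa]|A0] := pselect (exists a, A a); last first.
    by exists t0 => s As; case: A0; exists s.
  have [||||p [sp hp]] := @sublinear_inf [set q | exists2 s, A s & q = sval s] (sval a).
  + by exists a.
  + by move=> _ [s As ->]; exact: (svalP s).1.
  + move=> _ _ x y [s As ->] [t At ->].
    have [/asboolP st|/asboolP ts] := totA _ _ As At.
      exists (sval t); first by exists t.
      by apply: (le_trans ((svalP t).1.1 _ _)); rewrite lerD2r.
    exists (sval s); first by exists s.
    by apply: (le_trans ((svalP s).1.1 _ _)); rewrite lerD2l.
  + move=> x; exists (- p0 (- x)) => _ [s As ->].
    apply: le_trans (sublinearN _ (svalP s).1).
    by rewrite lerN2 (svalP s).2.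
  have pp0 x : p x <= p0 x.
    apply: (@le_trans _ _ (sval a x)); last exact: (svalP a).2.
    by apply: hp; exists a.
  by exists (exist _ p (conj sp pp0)) => s As; apply/asboolP => x; apply: hp; exists s.
- have pN y : p (- y) = - p y.
    have [q [sq qp qy]] := sublinear_shift y sp.
    have qp0 x : q x <= p0 x := le_trans (qp x) (pp0 x).
    have /asboolP /= pq := pmin (exist _ q (conj sq qp0)) (asboolT qp).
    apply/le_anti; rewrite (le_trans (pq _) qy) /=.
    by rewrite -[X in _ <= p X]opprK lerNl opprK; have := sublinearN (- y) sp; rewrite opprK; lra.
  exists p; split => // [x y|t x].
    apply/le_anti; rewrite sp.1 /=.
    have := sp.1 (- x) (- y); rewrite -opprD !pN; lra.
  have pZ (s : R) z : 0 < s -> p (s%:C%C *: z) = s * p z.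
    move=> s0; apply/le_anti; rewrite sp.2 //=.
    have := sp.2 s (- z) s0; rewrite scalerN !pN; lra.
  have [t0'|t0'|<-] := ltgtP 0 t; first exact: pZ.
    have -> : t%:C%C *: x = (- t)%:C%C *: - x by rewrite rmorphN scalerN scaleNr opprK.
    by rewrite pZ ?oppr_gt0 // pN mulrNN.
  by rewrite mul0r scale0r (sublinear0 sp).
Qed.

(** The norm is first shifted along [v], so that a real-linear minorant [p] satisfies
    [p (- v) <= - rnorm v], whence [p v > 0]. *)
Lemma functional_neq0 (v : X) : v != 0 -> exists f, functional f /\ f v = 1.
Proof.
move=> v0; have sN : sublinear rnorm.
  split; first exact: rnormD.
  by move=> t x t0; rewrite rnormZ modcR gtr0_norm.
have [q [sq qN qv]] := sublinear_shift v sN.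
have [p [pD pZ pq]] := sublinear_ge_linear sq.
have pN x : p (- x) = - p x.
  by have := pZ (-1) x; rewrite rmorphN scaleN1r mulN1r.
have ple x : `|p x| <= rnorm x.
  rewrite ler_norml (le_trans (pq x)) // andbT lerNl -pN.
  by rewrite (le_trans (pq _)) // (le_trans (qN _)) // rnormN.
have pv : 0 < p v.
  have := pq (- v); rewrite pN; have : 0 < rnorm v by rewrite rnorm_gt0.
  by lra.
(* This is the complex-linear functional with real part [p]. *)
pose g x : R[i] := (p x -i* p ('i%C *: x))%C.
have g1 : functional g.
  split => [[a b] x y|].
    have e1 (c d : R) : (c +i* d)%C = c%:C%C + d%:C%C * 'i%C.
      by apply/eqP; rewrite eq_complex /= !(mulr0, mul0r, mulr1, addr0, add0r, subr0, eqxx).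
    have e2 z : (a +i* b)%C *: z = a%:C%C *: z + b%:C%C *: ('i%C *: z).
      by rewrite e1 scalerDl scalerA.
    rewrite /g !scalerDr !e2 !pD !pZ !scalerDr !pD.
    rewrite !(scalerA 'i%C) !(mulrC 'i%C) -!(scalerA _ 'i%C) !pZ.
    have -> : 'i%C *: ('i%C *: x) = - x.
      by rewrite scalerA -expr2 sqr_i scaleN1r.
    by rewrite pN; apply/eqP; rewrite eq_complex /=; apply/andP; split; apply/eqP; ring.
  exists 2 => x; rewrite /g.
  have -> : (p x -i* p ('i%C *: x))%C = (p x)%:C%C - 'i%C * (p ('i%C *: x))%:C%C.
    by apply/eqP; rewrite eq_complex /= !(mulr0, mul0r, mul1r, addr0, add0r, subr0, oppr0, eqxx).
  apply: (le_trans (modcD _ _)); rewrite modcN modcM !modcR.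
  have i1 : modc ('i%C : R[i]) = 1 by rewrite /= expr0n expr1n add0r sqrtr1.
  rewrite i1 mul1r mulrDl !mul1r lerD //.
  by rewrite (le_trans (ple _)) // rnormZ i1 mul1r.
exists (fun x => (g v)^-1 * g x); split; first exact: functionalMl.
apply: mulVf; apply/eqP => /(congr1 (@complex.Re R)) /=; lra.
Qed.

End HahnBanach.

(** * Roots of unity close to 1 *)

Section RootsOfUnity.
Context {R : realType}.
Implicit Types (c z : R[i]) (k p r : nat).

(** The root has angle [t = 2 pi / 2 ^ p]. If its order were a proper divisor of [2 ^ p], its power
    [2 ^ (p - 1)] would be 1, but that power is -1. The distance to 1 is at most
    [|cos t - 1| + |sin t| <= 2 t], whence [C = 4 pi]. *)
Lemma unity_root_near1 : exists C : R, 0 < C /\ forall p, exists z : R[i],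
  [/\ z ^+ (2 ^ p) = 1, forall k, z ^+ k = 1 -> (2 ^ p %| k)%N &
     modc (z - 1) <= C / 2 ^+ p].
Proof.
exists (2 * (pi *+ 2)); split; first by rewrite mulr_gt0 // mulrn_wgt0 // pi_gt0.
move=> p; pose t : R := pi *+ 2 / 2 ^+ p; pose z := (cos t +i* sin t)%C.
have zX k : z ^+ k = (cos (t *+ k) +i* sin (t *+ k))%C.
  elim: k => [|k IH]; first by rewrite !mulr0n cos0 sin0.
  rewrite exprS IH !mulrS cosD sinD /z; apply/eqP.
  by rewrite eq_complex /= eqxx addrC (mulrC (cos t)) (mulrC (sin t)) /= addrC eqxx.
have p2 k : (2 : R) ^+ k != 0 by rewrite expf_neq0.
have tp : t *+ (2 ^ p) = pi *+ 2.
  by rewrite -mulr_natr natrX /t mulfVK.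
have z2p : z ^+ (2 ^ p) = 1.
  by rewrite zX tp mulr2n (cosD pi pi) (sinD pi pi) cospi sinpi; apply/eqP; rewrite eq_complex /= !(mulr0, mul0r, addr0, subr0) mulrNN mulr1 !eqxx.
have zN q : p = q.+1 -> z ^+ (2 ^ q) = - 1.
  move=> pq; have -> : z ^+ (2 ^ q) = (cos pi +i* sin pi)%C.
    rewrite zX; suff -> : t *+ (2 ^ q) = pi by [].
    by rewrite -mulr_natr natrX /t pq exprS -(mulr_natr pi 2) invfM mulrA mulfVK // mulfK.
  by rewrite cospi sinpi; apply/eqP; rewrite eq_complex /= oppr0 !eqxx.
have pi0 : 0 < pi *+ 2 :> R by rewrite mulr2n addr_gt0 ?pi_gt0.
have t0 : 0 < t by rewrite divr_gt0 ?exprn_gt0.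
exists z; split; [exact: z2p|move=> k zk|].
  have p0 : (0 < 2 ^ p)%N by rewrite expn_gt0.
  have [m pm] := prim_order_exists p0 z2p.
  case/dvdn_pfactor => // q; rewrite leq_eqVlt => /predU1P[-> <-|qp mq].
    by rewrite (prim_order_dvd pm) zk.
  have : z ^+ (2 ^ p.-1) = 1.
    apply/eqP; rewrite -(prim_order_dvd pm) mq dvdn_exp2l //.
    by rewrite -ltnS prednK // (leq_trans _ qp).
  rewrite zN ?prednK ?(leq_trans _ qp) // => /eqP.
  by rewrite eq_complex /= => /andP[/eqP ? _]; exfalso; lra.
(* The mean value theorem bounds the increments of cosine and sine between 0 and [t]. *)
have lip (f df : R -> R) : (forall x : R, is_derive x 1 f (df x)) -> continuous f ->
    (forall x : R, `|df x| <= 1) -> `|f t - f 0| <= t.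
  move=> dfx cf df1; have [c _ ->] : exists2 c, c \in `]0, t[ & f t - f 0 = df c * (t - 0).
    by apply: MVT => //; exact: continuous_subspaceT.
  by rewrite subr0 normrM (gtr0_norm t0) ler_piMl // ltW.
have hc : `|cos t - 1| <= t.
  rewrite -[1](@cos0 R).
  apply: (lip _ _ (fun x => is_derive_cos x) (@continuous_cos R)) => x.
  by rewrite normrN sin_max.
have hs : `|sin t| <= t.
  rewrite -[sin t]subr0 -[X in _ - X](@sin0 R).
  exact: (lip _ _ (fun x => is_derive_sin x) (@continuous_sin R) (@cos_max R)).
have -> : z - 1 = (cos t - 1)%:C%C + 'i%C * (sin t)%:C%C.
  by apply/eqP; rewrite eq_complex /= !(mulr0, mul0r, mul1r, addr0, add0r, subr0, oppr0, eqxx).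
apply: (le_trans (modcD _ _)); rewrite modcM !modcR.
have -> : modc ('i%C : R[i]) = 1 by rewrite /= expr0n expr1n add0r sqrtr1.
by rewrite -mulrA -/t; lra.
Qed.

Definition geosum z k := \sum_(i < k) z ^+ i.

Lemma geosumS z k : geosum z k.+1 = geosum z k + z ^+ k.
Proof. by rewrite /geosum big_ord_recr. Qed.

Lemma geosum_mul z k : z ^+ k - 1 = (z - 1) * geosum z k.
Proof. exact: subrX1. Qed.

Context {p : nat} {z : R[i]}.
Hypothesis z1 : z ^+ (2 ^ p) = 1.

Lemma modc_unity_root : modc z = 1.
Proof.
have : modc z ^+ (2 ^ p) = 1.
  have -> : modc z ^+ (2 ^ p) = modc (z ^+ (2 ^ p)).
    by elim: (2 ^ p)%N => [|n IH]; rewrite ?expr0 ?modc1 // !exprS modcM IH.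
  by rewrite z1 modc1.
by move/eqP; rewrite pexpr_eq1 ?expn_gt0 ?modc_ge0 // => /eqP.
Qed.

Lemma modc_unity_rootX k : modc (z ^+ k) = 1.
Proof.
by elim: k => [|k IH]; rewrite ?expr0 ?modc1 // exprS modcM IH modc_unity_root mul1r.
Qed.

Lemma geosum_le k : modc (geosum z k) <= k%:R.
Proof.
elim: k => [|k IH]; first by rewrite /geosum big_ord0 modc0.
rewrite geosumS -natr1 (le_trans (modcD _ _)) // lerD //.
by rewrite modc_unity_rootX.
Qed.

(* If [c ^+ M = 1] and [c <> 1] then [1 + c + ... + c ^+ (M - 1) = 0], so [M] is the sum of the [1 - c ^+ i], each of modulus at most [M |c - 1|]. *)
Lemma unity_power_far r k : (r <= p)%N -> (2 ^ r %| k)%N -> z ^+ k != 1 ->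
  2 ^+ r / 2 ^+ p <= modc (z ^+ k - 1).
Proof.
move=> rp rk; set c := z ^+ k => c1; pose M := (2 ^ (p - r))%N.
have cM : c ^+ M = 1.
  rewrite -exprM; case/dvdnP: rk => j ->.
  by rewrite -mulnA -expnD subnKC // mulnC exprM z1 expr1n.
have cle i : modc (c ^+ i - 1) <= i%:R * modc (c - 1).
  rewrite geosum_mul modcM mulrC ler_wpM2r ?modc_ge0 //.
  elim: i => [|i IH]; first by rewrite /geosum big_ord0 modc0.
  rewrite geosumS -natr1 (le_trans (modcD _ _)) // lerD //.
  by rewrite -exprM modc_unity_rootX.
have s0 : geosum c M = 0.
  have /esym/eqP := geosum_mul c M; rewrite cM subrr mulf_eq0 subr_eq0.
  by rewrite (negPf c1) => /eqP.
(* For [n <= M] each of the [n] differences [c ^+ i - 1] is at most [M |c - 1|]; the second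
   alternative lets the induction run past [M]. *)
have sle n : modc (geosum c n - n%:R) <= (n * M)%:R * modc (c - 1) \/ (M < n)%N.
  elim: n => [|n [IH|IH]].
  - by left; rewrite /geosum big_ord0 subrr modc0 mul0n mul0r.
  - have [Mn|nM] := ltnP M n.+1; [by right|left].
    have -> : geosum c n.+1 - n.+1%:R = geosum c n - n%:R + (c ^+ n - 1).
      by rewrite geosumS -natr1; ring.
    rewrite (le_trans (modcD _ _)) // mulSn natrD mulrDl addrC lerD //.
    by rewrite (le_trans (cle n)) // ler_wpM2r ?modc_ge0 // ler_nat ltnW.
  - by right; apply: ltnW; rewrite ltnS.
have {sle} := sle M; rewrite ltnn => -[|//]; rewrite s0 sub0r modcN.
have -> : modc (M%:R : R[i]) = M%:R.
  by rewrite -(rmorph_nat (real_complex R)) modcR ger0_norm.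
have M0 : 0 < M%:R :> R by rewrite ltr0n expn_gt0.
rewrite natrM -mulrA -[leLHS]mulr1 ler_pM2l // => h.
have -> : 2 ^+ r / 2 ^+ p = M%:R^-1 :> R.
  by rewrite /M natrX -{1}(subnK rp) exprD invfM mulrCA mulfV ?mulr1 // expf_neq0.
by rewrite -[leLHS]mulr1 ler_pdivrMl.
Qed.

End RootsOfUnity.

(** * Fundamental biorthogonal systems *)

Section BiorthogonalSystem.
Context {R : realType} {X : normedModType R[i]}.
Implicit Types (x y : X) (r : X -> X).

(** The remainders of the Gram-Schmidt process: bounded projections that change a vector only by an
    element of one fixed finite-dimensional span. *)
Definition finite_codim_proj r :=
  [/\ linear r, exists K : R, 0 <= K /\ forall x, rnorm (r x) <= K * rnorm x,
      forall x, r (r x) = r x & exists s, forall x, span_seq s (x - r x)].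

Lemma span_seq_rcons (s : seq X) v c x :
  span_seq s x -> span_seq (rcons s v) (x + c *: v).
Proof.
move=> [a ->]; exists (fun i => if (i < size s)%N then a i else c).
rewrite size_rcons big_ord_recr /= nth_rcons !ltnn eqxx; congr (_ + _).
by apply: eq_bigr => i _; rewrite nth_rcons ltn_ord.
Qed.

(** The direction [e] is taken along [r d], or anywhere in the range of [r] if [r d = 0]; either way
    the new projection kills [d]. Composing a functional with [r] makes [f] vanish on what [r]
    already kills. *)
Lemma finite_codim_step r d : infinite_dimensional (X := X) ->
  finite_codim_proj r -> exists e (f : X -> R[i]),
  [/\ [/\ rnorm e = 1, functional f & f e = 1], r e = e, forall x, f (r x) = f x,
     finite_codim_proj (fun x => r x - f x *: e) & r d = f d *: e].
Proof.
move=> dimX [lr [K [K0 hK]] rr [s hs]].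
have rZ c x : r (c *: x) = c *: r x.
  have r0 : r 0 = 0 by have := lr 1 0 0; rewrite !scale1r addr0 -{1}[r 0]addr0 => /addrI.
  by have := lr c x 0; rewrite r0 !addr0.
have [v [v0 rv dv]] : exists v, [/\ v != 0, r v = v & r d = 0 \/ r d = v].
  have [rd|rd] := eqVneq (r d) 0; last by exists (r d); split => //; right.
  (* If [x] is outside the span of [s] then [r x != 0], as [x - r x] lies in that span. *)
  have [x hx] := dimX s; exists (r x); split => //; last by left.
  by apply/eqP => rx; apply: hx; have := hs x; rewrite rx subr0.
have vn : (rnorm v)%:C%C != 0 :> R[i] by rewrite -rnormE normr_eq0.
have [e [en ve re]] : exists e, [/\ rnorm e = 1, v = (rnorm v)%:C%C *: e & r e = e].
  exists ((rnorm v)%:C%C^-1 *: v); split; last by rewrite rZ rv.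
    by rewrite rnormZ Normc.normcV modcR ger0_norm ?rnorm_ge0 // mulVf ?rnorm_eq0.
  by rewrite scalerA mulfV // scale1r.
have e0 : e != 0 by rewrite -rnorm_eq0 en oner_eq0.
have [g [fg ge]] := functional_neq0 e0.
have ff : functional (fun x => g (r x)).
  split => [a x y|]; first by rewrite lr fg.1.
  have [L [L0 hL]] := functional_bound fg; exists (L * K) => x.
  by rewrite (le_trans (hL _)) // -mulrA ler_wpM2l // ltW.
exists e, (fun x => g (r x)); split => //.
- by split => //; rewrite re.
- by move=> x; rewrite rr.
- split.
  + by move=> a x y; rewrite lr fg.1 /= scalerDl scalerBr scalerA opprD addrACA.
  + have [L [L0 hL]] := functional_bound ff; exists (K + L); split.
      by rewrite addr_ge0 // ltW.
    move=> x; rewrite (le_trans (rnormB _ _)) // mulrDl lerD //.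
    by rewrite rnormZ en mulr1.
  + move=> x; have rx' : r (r x - g (r x) *: e) = r x - g (r x) *: e.
      by rewrite addrC -scaleN1r scalerA lr rr re.
    by rewrite rx' (functionalB fg) (functionalZ fg) ge mulr1 subrr scale0r subr0.
  + exists (rcons s e) => x; rewrite opprB addrCA addrC.
    exact: span_seq_rcons.
- case: dv => [->|->]; first by rewrite (functional0 fg) scale0r.
  by rewrite {2}ve (functionalZ fg) ge mulr1 -ve.
Qed.

Lemma dense_sequence : separable_space (X := X) ->
  exists d : nat -> X, forall x (e : R), 0 < e -> exists n, rnorm (d n - x) < e.
Proof.
move=> [D [/countable_injP[f fi] cD]].
(* This inverts an injection of [D] into the naturals; indices outside its image get the value 0. *)
exists (fun n => xget 0 [set x | D x /\ f x = n]) => x e e0.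
have /closure_rnormP/(_ _ e0)[y [Dy yx]] : closure D x by rewrite cD.
have [Dz fz] := @xgetPex _ 0 [set x | D x /\ f x = f y] (ex_intro _ y (conj Dy erefl)).
by exists (f y); rewrite (fi _ y _ _ fz) //; exact: mem_set.
Qed.

(** Step [n] of the process treats [d n], and all later remainders kill it. This is the finite
    expansion in the last clause, by which the [E n] span a dense subspace. *)
Lemma biorthogonal_system :
  separable_space (X := X) -> infinite_dimensional (X := X) ->
  exists (d E : nat -> X) (F : nat -> X -> R[i]),
  [/\ forall x (e : R), 0 < e -> exists n, rnorm (d n - x) < e,
      forall n, rnorm (E n) = 1, forall n, functional (F n),
      forall i j, F i (E j) = (i == j)%:R &
      forall n m, (n < m)%N -> d n = \sum_(i < m) F i (d n) *: E i].
Proof.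
move=> sepX dimX; have [d dd] := dense_sequence sepX.
have step (a : nat * (X -> X)) : exists b : X * (X -> R[i]),
    finite_codim_proj a.2 ->
    [/\ [/\ rnorm b.1 = 1, functional b.2 & b.2 b.1 = 1],
     a.2 b.1 = b.1, forall x, b.2 (a.2 x) = b.2 x,
     finite_codim_proj (fun x => a.2 x - b.2 x *: b.1) &
     a.2 (d a.1) = b.2 (d a.1) *: b.1].
  have [pa|?] := pselect (finite_codim_proj a.2); last by exists (0, fun=> 0).
  by have [e [f ?]] := finite_codim_step (d a.1) dimX pa; exists (e, f).
have [g hg] := choice step.
pose r := fix r n := if n is k.+1 then
  (fun x => r k x - (g (k, r k)).2 x *: (g (k, r k)).1) else id.
have pr n : finite_codim_proj (r n).
  elim: n => [|n IH]; last by case: (hg (n, r n) IH).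
  split => //; first by exists 1; split => // x; rewrite mul1r.
  by exists [::] => x; exists (fun=> 0); rewrite big_ord0 subrr.
pose E n := (g (n, r n)).1; pose F n := (g (n, r n)).2.
have rS n x : r n.+1 x = r n x - F n x *: E n by [].
have P n := hg (n, r n) (pr n); rewrite /= in P.
have fF n : functional (F n) by have [[]] := P n.
have FE n : F n (E n) = 1 by have [[]] := P n.
have rE n : r n (E n) = E n by have [] := P n.
have Fr n x : F n (r n x) = F n x by have [_ _ h _ _] := P n; exact: h.
have rd n : r n (d n) = F n (d n) *: E n by have [] := P n.
(* Later remainders kill [E n], and [F n] vanishes on their ranges: these give [F i (E j) = 0] for
   [i > j] and for [i < j] respectively. *)
have rE0 n k : r (n.+1 + k)%N (E n) = 0.
  elim: k => [|k IH]; first by rewrite addn0 rS rE FE scale1r subrr.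
  by rewrite addnS rS -Fr IH (functional0 (fF _)) scale0r subr0.
have Fr0 n k x : F n (r (n.+1 + k)%N x) = 0.
  elim: k x => [|k IH] x.
    by rewrite addn0 rS (functionalB (fF n)) Fr (functionalZ (fF n)) FE mulr1 subrr.
  rewrite addnS rS (functionalB (fF n)) IH (functionalZ (fF n)) -[E _]rE IH.
  by rewrite mulr0 subr0.
exists d, E, F; split => //.
- by move=> n; have [[]] := P n.
- move=> i j; have [ij|ij|<-] := ltngtP i j; last by rewrite FE.
    by rewrite -[E j]rE -(subnKC ij) Fr0.
  by rewrite -Fr -(subnKC ij) rE0 (functional0 (fF _)).
- have sumE n x : x = r n x + \sum_(i < n) F i x *: E i.
    elim: n => [|n IH]; first by rewrite big_ord0 addr0.
    by rewrite big_ord_recr rS /= [_ + F n x *: _]addrC addrA subrK.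
  move=> n m /subnKC <-; set k := (m - n.+1)%N.
  suff rd0 : r (n.+1 + k)%N (d n) = 0 by rewrite {1}(sumE (n.+1 + k)%N (d n)) rd0 add0r.
  elim: k => [|k IH]; first by rewrite addn0 rS rd subrr.
  by rewrite addnS rS -Fr IH (functional0 (fF _)) scale0r subr0.
Qed.

End BiorthogonalSystem.

(** * Diagonal perturbations of the identity *)

Section SeriesAlongSequence.
Context {R : realType} {X : completeNormedModType R[i]}.
Context {e : nat -> X} (e1 : forall j, rnorm (e j) = 1).
Implicit Types (a : nat -> R[i]) (s : X).

Definition esum_to a s := tends (fun n => \sum_(i < n) a i *: e i) s.

Lemma esum_to_ex a (A : R) : (forall j, modc (a j) <= A * 2^-1 ^+ j) ->
  exists s, esum_to a s.
Proof.
(* The factor 2 makes the [n]-th term at most half of [B * 2^-1 ^+ n]; adding 1 makes [B]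
   positive. *)
move=> aA; pose B := 2 * (`|A| + 1).
have B0 : 0 < B by rewrite mulr_gt0 // ltr_wpDl.
have q0 n : 0 < 2^-1 ^+ n :> R by rewrite exprn_gt0 // invr_gt0.
have [||n|l hl] := @geometric_limit _ _ (fun n => \sum_(i < n) a i *: e i)
   (fun n => B * 2^-1 ^+ n).
- by move=> n; rewrite mulr_gt0.
- by move=> n; rewrite exprSr mulrA.
- rewrite big_ord_recr /= addrAC subrr add0r rnormZ e1 mulr1.
  apply: (le_trans (aA n)); have -> : B * 2^-1 ^+ n / 2 = (`|A| + 1) * 2^-1 ^+ n.
    by rewrite /B; set q := _ ^+ n; lra.
  by rewrite ler_wpM2r ?(ltW (q0 _)) // (le_trans (ler_norm _)) // lerDl.
exists l => d d0; have [M hM] := half_small B d0.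
by exists M => n /hM; apply: le_lt_trans; rewrite rdistC; exact: hl.
Qed.

Lemma esum_to_unique a s t : esum_to a s -> esum_to a t -> s = t.
Proof.
move=> hs ht; apply/eqP; rewrite -subr_eq0; apply/eqP/rnorm_small => d d0.
have d2 : 0 < d / 2 by rewrite divr_gt0.
have [M hM] := hs _ d2; have [N hN] := ht _ d2.
have := hM _ (leq_maxl M N); have := hN _ (leq_maxr M N).
set y := \sum_(i < _) _; have := rdistD y s t; rewrite (rdistC s y); lra.
Qed.

Lemma esum_to_lin a a' s s' c : esum_to a s -> esum_to a' s' ->
  esum_to (fun j => c * a j + a' j) (c *: s + s').
Proof.
move=> hs ht d d0; have c0 : 0 < modc c + 1 by rewrite ltr_wpDl ?modc_ge0.
have d2 : 0 < d / 2 by rewrite divr_gt0.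
have [M hM] := hs _ (divr_gt0 d2 c0); have [N hN] := ht _ d2.
exists (maxn M N) => n; rewrite geq_max => /andP[/hM + /hN].
under [in X in _ -> _ -> X]eq_bigr do rewrite scalerDl -scalerA.
rewrite big_split -scaler_sumr /=; set y := \sum_(i < _) _; set z := \sum_(i < _) _.
rewrite opprD addrACA -scalerBr => h1 h2; apply: (le_lt_trans (rnormD _ _)).
rewrite rnormZ; have : modc c * rnorm (y - s) <= (modc c + 1) * rnorm (y - s).
  by rewrite ler_wpM2r ?rnorm_ge0 // lerDl.
by move: h1; rewrite ltr_pdivlMr // mulrC; lra.
Qed.

Lemma esum_to_functional a s phi j : functional phi ->
  (forall i, i != j -> phi (e i) = 0) -> esum_to a s -> phi s = a j * phi (e j).
Proof.
move=> fphi pe hs; apply/eqP.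
rewrite -(functionalZ fphi) -subr_eq0 -(functionalB fphi); apply/eqP.
apply: functional_small => // d d0; have [M hM] := hs _ d0.
exists (\sum_(i < j.+1 + M) a i *: e i - a j *: e j); split.
  rewrite (functionalB fphi) (functional_sum fphi _ (fun i => a i *: e i)).
  rewrite (bigD1 (Ordinal (ltn_addr M (ltnSn j)))) //= addrAC subrr add0r.
  by apply: big1 => i ij; rewrite (functionalZ fphi) pe ?mulr0.
by rewrite opprB addrA subrK hM // leq_addl.
Qed.

Lemma esum_to_le a s (B : R) :
  (forall n, rnorm (\sum_(i < n) a i *: e i) <= B) -> esum_to a s -> rnorm s <= B.
Proof.
move=> aB hs; apply/ler_addgt0Pl => d d0; have [M hM] := hs _ d0.
have := hM M (leqnn M); have := aB M; set y := \sum_(i < _) _.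
by have := rdistD y s 0; rewrite !subr0 (rdistC s y); lra.
Qed.

(* The partial sums telescope against [B (2 ^ -n - 2 ^ - m)]. *)
Lemma esum_to_tail a s n (A B : R) : esum_to a s -> 0 <= B ->
  (forall j, (j < n)%N -> a j = 0) -> modc (a n) <= A ->
  (forall j, (n < j)%N -> modc (a j) <= B * 2^-1 ^+ j) ->
  rnorm s <= A + B * 2^-1 ^+ n.
Proof.
move=> hs B0 a0 an aB.
have q0 k : 0 <= 2^-1 ^+ k :> R by rewrite exprn_ge0 // invr_ge0.
have A0 : 0 <= A := le_trans (modc_ge0 _) an.
have z m : (m <= n)%N -> \sum_(i < m) a i *: e i = 0.
  by move=> mn; apply: big1 => i _; rewrite a0 ?scale0r // (leq_trans _ mn).
have h k : rnorm (\sum_(i < n.+1 + k) a i *: e i) <=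
    A + B * (2^-1 ^+ n - 2^-1 ^+ (n + k)%N).
  elim: k => [|k IH].
    by rewrite !addn0 big_ord_recr /= z // add0r rnormZ e1 mulr1 subrr mulr0 addr0.
  rewrite addnS big_ord_recr /= (le_trans (rnormD _ _)) // rnormZ e1 mulr1.
  have := aB (n.+1 + k)%N (leq_addr _ _); move: IH; rewrite addnS addSn exprS.
  by set q := 2^-1 ^+ (n + k); set q' := 2^-1 ^+ n; lra.
apply: esum_to_le hs => m; have [mn|mn] := leqP m n.
  by rewrite z // rnorm0 addr_ge0 // mulr_ge0.
rewrite -(subnKC mn); apply: (le_trans (h _)); rewrite lerD2l ler_wpM2l //.
by rewrite lerBlDr lerDl.
Qed.

End SeriesAlongSequence.

Section DiagonalPerturbation.
Context {R : realType} {X : completeNormedModType R[i]}.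
Context {e : nat -> X} {h : nat -> X -> R[i]} {lam : nat -> R[i]} {K : R}.
Hypothesis e1 : forall j, rnorm (e j) = 1.
Hypothesis fh : forall j, functional (h j).
Hypothesis hK : forall j x, modc (h j x) <= K * rnorm x * 2^-1 ^+ j.
Hypothesis he : forall i j, i != j -> h j (e i) = 0.
Hypothesis hee : forall j, h j (e j) = lam j - 1.
Implicit Types (x y : X).

(** The default 0 makes the sum a total function; under the bound [hK] the series always
    converges. *)
Definition idplus x : X := x + xget 0 [set s | esum_to (e := e) (h^~ x) s].

Lemma idplus_sum x : esum_to (e := e) (h^~ x) (idplus x - x).
Proof.
rewrite /idplus addrAC subrr add0r.
exact: (@xgetPex _ 0 [set s | esum_to (h^~ x) s] (esum_to_ex e1 (hK^~ x))).
Qed.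

Lemma idplus_linear : linear idplus.
Proof.
move=> a x y; apply: (@addIr _ (- (a *: x + y))).
apply: esum_to_unique (idplus_sum _) _.
have -> : a *: idplus x + idplus y - (a *: x + y) =
    a *: (idplus x - x) + (idplus y - y) by rewrite scalerBr opprD addrACA.
have -> : h^~ (a *: x + y) = (fun j => a * h j x + h j y).
  by apply/funext => j; rewrite (fh j).1.
by apply: esum_to_lin; exact: idplus_sum.
Qed.

Lemma idplus_bounded : bounded_operator idplus.
Proof.
split; first exact: idplus_linear.
apply: (@linear_bounded_cont _ _ _ (1 + (2 * `|K|))); first exact: idplus_linear.
move=> x; rewrite mulrDl mul1r -[X in rnorm X](subrK x) addrC.
apply: (le_trans (rnormD _ _)); rewrite lerD2l.
have K0 : 0 <= `|K| * rnorm x by rewrite mulr_ge0 ?rnorm_ge0.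
have hK' j : modc (h j x) <= `|K| * rnorm x * 2^-1 ^+ j.
  apply: (le_trans (hK j x)); rewrite ler_wpM2r ?exprn_ge0 ?invr_ge0 //.
  by rewrite ler_wpM2r ?rnorm_ge0 ?ler_norm.
have := esum_to_tail e1 (idplus_sum x) K0 _ (hK' 0%N) (fun j _ => hK' j).
by rewrite expr0 => /(_ ltac:(by [])); lra.
Qed.

(** Since [h j] annihilates every [e i] with [i != j], it is multiplied by [lam j] at each
    iteration; summing the increments [lam j ^+ k * h j x] builds the geometric sum. *)
Lemma idplus_iter k x :
  esum_to (e := e) (fun j => geosum (lam j) k * h j x) (iter k idplus x - x).
Proof.
elim: k => [|k IH].
  move=> d d0; exists 0%N => n _; rewrite /= subrr big1 ?subr0 ?rnorm0 // => i _.
  by rewrite /geosum big_ord0 mul0r scale0r.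
have -> : iter k.+1 idplus x - x =
    1 *: (idplus (iter k idplus x) - iter k idplus x) + (iter k idplus x - x).
  by rewrite scale1r subrKA.
have -> : (fun j => geosum (lam j) k.+1 * h j x) =
    (fun j => 1 * h j (iter k idplus x) + geosum (lam j) k * h j x).
  apply/funext => j; rewrite mul1r.
  have -> : h j (iter k idplus x) = h j (iter k idplus x - x) + h j x.
    by rewrite -(functionalD (fh j)) subrK.
  rewrite (esum_to_functional (fh j) _ IH (j := j)); last by move=> i; exact: he.
  rewrite hee geosumS; have := geosum_mul (lam j) k.
  by move/(canRL (subrK _)) ->; ring.
by apply: esum_to_lin IH; exact: idplus_sum.
Qed.

Lemma idplus_iter_coord f k j x : functional f ->
  (forall i, i != j -> f (e i) = 0) ->
  f (iter k idplus x - x) = geosum (lam j) k * h j x * f (e j).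
Proof. by move=> ff fe; rewrite (esum_to_functional ff fe (idplus_iter k x)). Qed.

Lemma idplus_iter_id k x : (forall j, geosum (lam j) k * h j x = 0) ->
  iter k idplus x = x.
Proof.
move=> z; apply/eqP; rewrite -subr_eq0; apply/eqP.
apply: esum_to_unique (idplus_iter k x) _ => d d0; exists 0%N => n _.
by rewrite subr0 big1 ?rnorm0 // => i _; rewrite z scale0r.
Qed.

End DiagonalPerturbation.

(** * The recurrent operator *)

Section Recurrence.
Context {R : realType} {X : normedModType R[i]}.

(** Return times are chosen greedily, each beyond the previous one; starting from bound 0 makes the
    first one positive. *)
Lemma recurrent_vectorP (T : X -> X) (x : X) :
  (forall (d : R) N, 0 < d -> exists k, (N < k)%N /\ rnorm (iter k T x - x) < d) ->
  recurrent_vector T x.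
Proof.
move=> rx; have next (a : nat * nat) : exists k, (a.1 < k)%N /\
    rnorm (iter k T x - x) < 2^-1 ^+ a.2.
  by apply: rx; rewrite exprn_gt0 // invr_gt0.
have [g hg] := choice next.
pose w := fix w n := if n is k.+1 then g (w k, k.+1) else g (0, 0)%N.
have wS n : (w n < w n.+1)%N by case: (hg (w n, n.+1)).
have wd n : rnorm (iter (w n) T x - x) < 2^-1 ^+ n.
  by case: n => [|n]; [case: (hg (0, 0)%N)|case: (hg (w n, n.+1))].
have w0 : (0 < w 0)%N by case: (hg (0, 0)%N).
exists w; split; first split.
- by move=> m n; exact: (homo_ltn ltn_trans wS).
- by elim=> [//|n IH]; exact: ltn_trans IH (wS n).
- apply/tendsP => d d0; have [M hM] := half_small 1 d0.
  by exists M => n /hM; rewrite mul1r; apply: lt_trans.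
Qed.

End Recurrence.

Section WildOperator.
Context {R : realType} {X : completeNormedModType R[i]}.
Context {e : nat -> X} {f : nat -> X -> R[i]} {u1 u2 : X -> R[i]} {g1 g2 : X}.
Context {b : nat -> nat} {al be lam : nat -> R[i]} {C W : R}.
Hypothesis e1 : forall j, rnorm (e j) = 1.
Hypothesis ff : forall j, functional (f j).
Hypothesis fe : forall i j, f i (e j) = (i == j)%:R.
Hypothesis fb : forall j x, modc (f j x) <= 2 ^+ b j * rnorm x.
Hypothesis fu1 : functional u1.
Hypothesis fu2 : functional u2.
Hypothesis u1e : forall j, u1 (e j) = 0.
Hypothesis u2e : forall j, u2 (e j) = 0.
Hypothesis u1g1 : u1 g1 = 1.
Hypothesis u1g2 : u1 g2 = 0.
Hypothesis u2g2 : u2 g2 = 1.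
Hypothesis uW : forall x, modc (u1 x) + modc (u2 x) <= W * rnorm x.
Hypothesis W0 : 0 < W.
Hypothesis C0 : 0 < C.
Hypothesis abe : forall j, modc (al j) + modc (be j) = 1.

(** [2 ^ expo j] is [m_j]. With this increment, [2 ^ b i] and [2 ^ b i.+1] times [m_i / m_(i+1)] are
    both at most [2 ^ - (i + 1)]. *)
Fixpoint expo j := if j is i.+1 then (expo i + i.+1 + b i + b i.+1)%N else 0%N.

Hypothesis lam1 : forall j, lam j ^+ (2 ^ expo j.+1) = 1.
Hypothesis lamd : forall j k, lam j ^+ k = 1 -> (2 ^ expo j.+1 %| k)%N.
Hypothesis lamC : forall j, modc (lam j - 1) <= C / 2 ^+ expo j.+1.

(** Vanishes exactly where [(u1 x, u2 x)] is proportional to [(al j, be j)]. *)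
Definition wfun j x := al j * u2 x - be j * u1 x.

Definition hfun j x :=
  (lam j - 1) * f j x + (2 ^+ b j / 2 ^+ expo j)%:C%C * wfun j x.

Hypothesis wdense : forall x (d : R) N, 0 < d ->
  exists n y, [/\ (N <= n)%N, rnorm (y - x) < d & wfun n y = 0].
Hypothesis edense : forall x (d : R), 0 < d -> u1 x = 0 -> u2 x = 0 ->
  exists (c : nat -> R[i]) n, rnorm (\sum_(i < n) c i *: e i - x) < d.

(** * Size of the functionals and boundedness of the operator *)

Let p2_gt0 n : 0 < 2 ^+ n :> R. Proof. by rewrite exprn_gt0. Qed.
Let h2_gt0 n : 0 < 2^-1 ^+ n :> R. Proof. by rewrite exprn_gt0 // invr_gt0. Qed.

Lemma ratio_half a c j : (a + j <= c)%N -> 2 ^+ a / 2 ^+ c <= 2^-1 ^+ j :> R.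
Proof.
move=> h; rewrite ler_pdivrMr // exprVn ler_pdivlMl // -exprD addnC.
by rewrite ler_eXn2l ?ltr1n.
Qed.

Lemma expo_homo i j : (i <= j)%N -> (expo i <= expo j)%N.
Proof.
by move=> /subnKC <-; elim: (j - i)%N => [|k IH]; rewrite ?addn0 // addnS /=; lia.
Qed.

Lemma expo_ge j : (j <= expo j)%N.
Proof. by elim: j => //= j IH; lia. Qed.

Lemma functional_wfun j : functional (wfun j).
Proof.
have := functionalDZ (al j) fu2 (functionalMl (- be j) fu1).
by congr functional; apply/funext => x; rewrite /wfun mulNr.
Qed.

Lemma functional_hfun j : functional (hfun j).
Proof. exact: functionalDZ (ff j) (functionalMl _ (functional_wfun j)). Qed.

Lemma wfun_le j x : modc (wfun j x) <= W * rnorm x.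
Proof.
apply: le_trans (uW x); rewrite (le_trans (modcD _ _)) // modcN !modcM addrC.
have a1 := abe j; have a0 := modc_ge0 (al j); have b0 := modc_ge0 (be j).
by rewrite lerD // ler_piMl ?modc_ge0 //; lra.
Qed.

Lemma hfun_le j x : modc (hfun j x) <=
  C * (2 ^+ b j / 2 ^+ expo j.+1) * rnorm x + 2 ^+ b j / 2 ^+ expo j * modc (wfun j x).
Proof.
rewrite (le_trans (modcD _ _)) // !modcM lerD //; last first.
  by rewrite modcR ger0_norm // divr_ge0 // ltW.
have -> : C * (2 ^+ b j / 2 ^+ expo j.+1) * rnorm x =
    (C / 2 ^+ expo j.+1) * (2 ^+ b j * rnorm x) by ring.
by rewrite ler_pM ?modc_ge0.
Qed.

(** The factor [2 ^+ b 0] accounts for [j = 0], where [expo 0 = 0] leaves the coupling undamped. *)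
Lemma hfun_bounded j x :
  modc (hfun j x) <= (C + 2 ^+ b 0 * W) * rnorm x * 2^-1 ^+ j.
Proof.
apply: (le_trans (hfun_le j x)).
have -> : (C + 2 ^+ b 0 * W) * rnorm x * 2^-1 ^+ j =
   C * 2^-1 ^+ j * rnorm x + 2 ^+ b 0 * 2^-1 ^+ j * (W * rnorm x) by ring.
rewrite lerD //.
  by rewrite ler_wpM2r ?rnorm_ge0 // ler_pM2l // ratio_half //=; lia.
rewrite ler_pM ?modc_ge0 ?wfun_le ?divr_ge0 ?(ltW (p2_gt0 _)) //.
case: j => [|j]; first by rewrite /= !expr0 divr1 mulr1.
rewrite (le_trans (ratio_half (j := j.+1) _)) //=; first lia.
by rewrite ler_peMl ?(ltW (h2_gt0 _)) // exprn_ege1 // ler1n.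
Qed.

Lemma hfun_e i j : i != j -> hfun j (e i) = 0.
Proof.
by move=> ij; rewrite /hfun /wfun u1e u2e fe eq_sym (negPf ij) !mulr0 subr0 mulr0 addr0.
Qed.

Lemma hfun_ee j : hfun j (e j) = lam j - 1.
Proof. by rewrite /hfun /wfun u1e u2e fe eqxx !mulr0 subr0 mulr0 addr0 mulr1. Qed.

Definition wild : X -> X := idplus (e := e) (h := hfun).

Lemma wild_bounded : bounded_operator wild.
Proof. exact: idplus_bounded e1 functional_hfun hfun_bounded. Qed.

Let coord j k x : f j (iter k wild x - x) = geosum (lam j) k * hfun j x.
Proof.
rewrite (@idplus_iter_coord _ _ _ _ _ _ e1 functional_hfun hfun_bounded hfun_e hfun_ee
  (f j) k j x (ff j)).
  by rewrite fe eqxx mulr1.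
by move=> i ij; rewrite fe eq_sym (negPf ij).
Qed.

(** * Return times: estimates in both directions *)

Lemma lam_neq1 j : lam j != 1.
Proof.
apply/eqP => l1; have := @lamd j 1%N; rewrite expr1 => /(_ l1).
by rewrite dvdn1 -[1%N](expn0 2) eqn_exp2l //=; lia.
Qed.

Lemma geosum_eq0 j k : (2 ^ expo j.+1 %| k)%N -> geosum (lam j) k = 0.
Proof.
case/dvdnP => i ->; have := geosum_mul (lam j) (i * 2 ^ expo j.+1).
rewrite mulnC exprM lam1 expr1n subrr => /esym/eqP.
by rewrite mulf_eq0 subr_eq0 (negPf (lam_neq1 j)) => /eqP.
Qed.

(** The power [lam j ^+ k] is at least [2 ^ r / m_(j+1)] away from 1, while [lam j] is within
    [C / m_(j+1)]; the geometric sum is the quotient. *)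
Lemma geosum_far j k r : (r <= expo j.+1)%N -> (2 ^ r %| k)%N ->
  ~~ (2 ^ expo j.+1 %| k)%N -> 2 ^+ r <= C * modc (geosum (lam j) k).
Proof.
move=> rj rk nk; have l1 : lam j ^+ k != 1.
  by apply: contra nk => /eqP; exact: lamd.
have := unity_power_far (lam1 j) rj rk l1; rewrite geosum_mul modcM.
rewrite ler_pdivrMr // => h; apply: (le_trans h); rewrite mulrAC.
by rewrite ler_wpM2r ?modc_ge0 // -ler_pdivlMr.
Qed.

(** Terms below [n] vanish as [m_(j+1)] divides [m_n]. In term [n] the factor [m_n] of the geometric
    sum cancels the denominator of the coupling. Beyond [n] it is beaten by [m_j]. *)
Lemma wild_near n q : rnorm (iter (2 ^ expo n) wild q - q) <=
  2 ^+ b n * modc (wfun n q) + (2 * C + W) * rnorm q * 2^-1 ^+ n.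
Proof.
have q0 := rnorm_ge0 q.
have CW0 : 0 <= (C + W) * rnorm q by rewrite mulr_ge0 // addr_ge0 // ltW.
have sum := idplus_iter e1 functional_hfun hfun_bounded hfun_e hfun_ee (2 ^ expo n) q.
have term j : modc (geosum (lam j) (2 ^ expo n) * hfun j q) <=
    C * (2 ^+ (expo n + b j) / 2 ^+ expo j.+1) * rnorm q +
    2 ^+ (expo n + b j) / 2 ^+ expo j * modc (wfun j q).
  rewrite modcM; have := geosum_le (lam1 j) (2 ^ expo n); rewrite natrX => gl.
  apply: le_trans (ler_pM (modc_ge0 _) (modc_ge0 _) gl (hfun_le j q)) _.
  by rewrite exprD le_eqVlt; apply/orP; left; apply/eqP; ring.
have -> : 2 ^+ b n * modc (wfun n q) + (2 * C + W) * rnorm q * 2^-1 ^+ n =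
   (C * 2^-1 ^+ n * rnorm q + 2 ^+ b n * modc (wfun n q)) +
   (C + W) * rnorm q * 2^-1 ^+ n by ring.
apply: (esum_to_tail e1 sum CW0) => [j jn||j nj].
- by rewrite geosum_eq0 ?mul0r // dvdn_exp2l // expo_homo.
- apply: (le_trans (term n)); rewrite lerD //.
    by rewrite ler_wpM2r // ler_pM2l // ratio_half //=; lia.
  by rewrite exprD [_ * _ / _]mulrAC mulfV ?mul1r // gt_eqF.
- apply: (le_trans (term j)).
  have -> : (C + W) * rnorm q * 2^-1 ^+ j =
    C * 2^-1 ^+ j * rnorm q + 2^-1 ^+ j * (W * rnorm q) by ring.
  have /expo_homo nj' := nj; rewrite lerD //.
    rewrite ler_wpM2r // ler_pM2l // ratio_half //.
    have := expo_homo (ltnW nj); move=> /=; lia.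
  rewrite ler_pM ?modc_ge0 ?wfun_le ?divr_ge0 ?(ltW (p2_gt0 _)) //.
  rewrite ratio_half //; case: j nj {nj'} => // j nj.
  by have := expo_homo (nj : (n <= j)%N); move=> /=; lia.
Qed.

Lemma Lset_tends w x : Lset wild w x <-> tends (fun n => iter (w n) wild x) x.
Proof. exact: tendsP. Qed.

(* The [j]-th coordinate of [T ^ k x - x] is [geosum (lam j) k * hfun j x], and its first factor is zero or at least [1 / C]. *)
Lemma Lset_dvd w j q : Lset wild w q -> hfun j q != 0 ->
  exists M, forall n, (M <= n)%N -> (2 ^ expo j.+1 %| w n)%N.
Proof.
move=> /Lset_tends wq hq; have hq0 : 0 < modc (hfun j q).
  by rewrite lt0r modc_ge0 modc_eq0 hq.
have d0 : 0 < modc (hfun j q) / (C * 2 ^+ b j).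
  by rewrite divr_gt0 // mulr_gt0.
have [M hM] := wq _ d0; exists M => n /hM; apply: contraTT => nd.
have := geosum_far (leq0n _) (dvd1n _) nd; rewrite expr0 => g1'.
rewrite -leNgt ler_pdivrMr ?mulr_gt0 //.
have := fb j (iter (w n) wild q - q); rewrite coord modcM => h.
set D := rnorm _ in h *.
apply: (@le_trans _ _ (C * (modc (geosum (lam j) (w n)) * modc (hfun j q)))).
  by rewrite mulrA ler_peMl // ltW.
by rewrite [D * _]mulrCA ler_pM2l // [D * _]mulrC.
Qed.

(** The geometric sum is at least [m_j / C], which cancels the [m_j] of the coupling, whose
    [2 ^ b j] cancels the bound on [f j]. The part [(lam j - 1) * f j x] leaves an error of order
    [m_j / m_(j+1)]. *)
Lemma wfun_near k j x : (2 ^ expo j %| k)%N -> ~~ (2 ^ expo j.+1 %| k)%N ->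
  modc (wfun j x) <= C * rnorm (iter k wild x - x) + C * 2^-1 ^+ j * rnorm x.
Proof.
move=> dk ndk; set D := rnorm _.
have g0 := geosum_far (expo_homo (leqnSn j)) dk ndk.
have := fb j (iter k wild x - x); rewrite coord modcM -/D => h.
have hw : 2 ^+ b j / 2 ^+ expo j * modc (wfun j x) <= modc (hfun j x) +
    C * (2 ^+ b j / 2 ^+ expo j.+1) * rnorm x.
  have -> : 2 ^+ b j / 2 ^+ expo j * modc (wfun j x) =
     modc ((2 ^+ b j / 2 ^+ expo j)%:C%C * wfun j x).
    by rewrite modcM modcR ger0_norm // divr_ge0 // ltW.
  have -> : (2 ^+ b j / 2 ^+ expo j)%:C%C * wfun j x =
     hfun j x - (lam j - 1) * f j x by rewrite /hfun addrAC subrr add0r.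
  rewrite (le_trans (modcD _ _)) // modcN lerD2l modcM.
  have -> : C * (2 ^+ b j / 2 ^+ expo j.+1) * rnorm x =
    (C / 2 ^+ expo j.+1) * (2 ^+ b j * rnorm x) by ring.
  by rewrite ler_pM ?modc_ge0.
rewrite -(ler_pM2l (p2_gt0 (b j))).
have -> : 2 ^+ b j * modc (wfun j x) =
    2 ^+ expo j * (2 ^+ b j / 2 ^+ expo j * modc (wfun j x)).
  by rewrite mulrA mulrCA mulfV ?mulr1 // gt_eqF.
apply: le_trans (ler_wpM2l (ltW (p2_gt0 _)) hw) _.
rewrite !mulrDr lerD //.
  apply: (@le_trans _ _ (C * modc (geosum (lam j) k) * modc (hfun j x))).
    by rewrite ler_wpM2r ?modc_ge0.
  by rewrite -mulrA (mulrCA _ C) ler_pM2l.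
have -> : 2 ^+ expo j * (C * (2 ^+ b j / 2 ^+ expo j.+1) * rnorm x) =
  2 ^+ b j * (C * (2 ^+ expo j / 2 ^+ expo j.+1) * rnorm x) by ring.
rewrite ler_pM2l // ler_wpM2r ?rnorm_ge0 // ler_pM2l // ratio_half //=; lia.
Qed.

(** The least [j] violating divisibility works, since [2 ^ expo 0 = 1] divides [k]. *)
Lemma first_nondivisor k : (0 < k)%N -> exists j,
  (2 ^ expo j %| k)%N /\ ~~ (2 ^ expo j.+1 %| k)%N.
Proof.
move=> k0; have nk : exists j, ~~ (2 ^ expo j.+1 %| k)%N.
  exists k; apply/negP => /(dvdn_leq k0).
  rewrite leqNgt (leq_trans (ltn_expl k (isT : (1 < 2)%N))) //.
  by rewrite leq_exp2l // (leq_trans (leqnSn k)) // expo_ge.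
case: (ex_minnP nk) => j nj jmin; exists j; split => //.
by case: j nj jmin => // j _ jmin; apply: contraT => /jmin; rewrite ltnn.
Qed.

(** The determinant times [al j] or [be j] is a combination of [wfun j x] and [wfun j y]; the two
    moduli are added using [abe]. *)
Lemma minors_small j x y : modc (u1 x * u2 y - u2 x * u1 y) <=
  W * rnorm x * modc (wfun j y) + W * rnorm y * modc (wfun j x).
Proof.
set D := u1 x * u2 y - u2 x * u1 y.
have ea : al j * D = u1 x * wfun j y - u1 y * wfun j x by rewrite /D /wfun; ring.
have eb : be j * D = u2 x * wfun j y - u2 y * wfun j x by rewrite /D /wfun; ring.
rewrite -[modc D]mul1r -(abe j) mulrDl -!modcM ea eb.
apply: le_trans (lerD (modcD _ _) (modcD _ _)) _; rewrite !modcN !modcM addrACA -!mulrDl.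
by rewrite lerD // ler_wpM2r ?modc_ge0.
Qed.

Definition eventually_divisible (w : nat -> nat) :=
  forall j, exists M, forall n, (M <= n)%N -> (2 ^ expo j.+1 %| w n)%N.

(** The first [j] such that [m_(j+1)] does not divide [w n] tends to infinity with [n]. At this [j]
    both [wfun j x] and [wfun j y] are small, hence so is the determinant. *)
Lemma Lset_proportional w x y : incr_pos w -> eventually_divisible w ->
  Lset wild w x -> Lset wild w y -> u1 x * u2 y - u2 x * u1 y = 0.
Proof.
move=> [_ wpos] wdiv /Lset_tends wx /Lset_tends wy.
have wdiv' J : exists M, forall n, (M <= n)%N ->
    forall j, (j < J)%N -> (2 ^ expo j.+1 %| w n)%N.
  elim: J => [|J [M hM]]; first by exists 0%N.
  have [N hN] := wdiv J; exists (maxn M N) => n; rewrite geq_max => /andP[Mn Nn] j.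
  by rewrite ltnS leq_eqVlt => /predU1P[->|]; [exact: hN|exact: hM].
apply/eqP; rewrite -modc_eq0; apply/eqP/le_anti; rewrite modc_ge0 andbT.
pose G := W * rnorm x * (C * (1 + rnorm y)) + W * rnorm y * (C * (1 + rnorm x)).
have G0 : 0 <= G.
  by rewrite addr_ge0 // !mulr_ge0 ?addr_ge0 ?rnorm_ge0 // ltW.
apply/ler_addgt0Pl => d d0; rewrite addr0.
have d1 : 0 < d / (G + 1) by rewrite divr_gt0 // ltr_wpDl.
set d' := d / (G + 1) in d1.
have [J hJ] := half_small 1 d1; have [M1 h1] := wdiv' J.
have [M2 h2] := wx _ d1; have [M3 h3] := wy _ d1.
set n := maxn M1 (maxn M2 M3).
have {}h1 := h1 n (leq_maxl _ _).
have {}h2 : rnorm (iter (w n) wild x - x) < d'.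
  by apply: h2; rewrite /n leq_max leq_maxl orbT.
have {}h3 : rnorm (iter (w n) wild y - y) < d'.
  by apply: h3; rewrite /n leq_max leq_maxr orbT.
have [j [jd nj]] := first_nondivisor (wpos n).
have Jj : (J <= j)%N by rewrite leqNgt; apply: contra nj; exact: h1.
have {}hJ := hJ j Jj; rewrite mul1r in hJ.
have wle z : rnorm (iter (w n) wild z - z) < d' ->
    modc (wfun j z) <= C * (1 + rnorm z) * d'.
  move=> hz; apply: (le_trans (wfun_near z jd nj)).
  rewrite mulrDr mulr1 mulrDl lerD ?ler_pM2l ?(ltW hz) //.
  by rewrite mulrAC ler_wpM2l ?(ltW hJ) // mulr_ge0 ?rnorm_ge0 // ltW.
apply: (le_trans (minors_small j x y)).
apply: (@le_trans _ _ (G * d')).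
  rewrite mulrDl -!mulrA lerD //.
    by rewrite ler_pM2l // ler_wpM2l ?rnorm_ge0 // mulrA wle.
  by rewrite ler_pM2l // ler_wpM2l ?rnorm_ge0 // mulrA wle.
by rewrite /d' mulrCA ler_piMr ?(ltW d0) // ler_pdivrMr ?ltr_wpDl // mul1r lerDl.
Qed.

Lemma functional_minor x : functional (fun y => u1 x * u2 y - u2 x * u1 y).
Proof.
have := functionalDZ (u1 x) fu2 (functionalMl (- u2 x) fu1).
by congr functional; apply/funext => y; rewrite mulNr.
Qed.

(** A nonzero bounded functional vanishes on the set: the determinant against one of its vectors, or
    [u1], if [w] is eventually divisible; otherwise some [hfun j]. *)
Lemma wild_Lset_not_dense w : incr_pos w -> closure (Lset wild w) <> setT.
Proof.
move=> wpos cL; have inL x : closure (Lset wild w) x by rewrite cL.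
have [wdiv|] := pselect (eventually_divisible w).
  have [[x [Lx ux]]|nx] := pselect (exists x, Lset wild w x /\ u1 x != 0).
    have := closure_zero (functional_minor x)
      (fun y => Lset_proportional wpos wdiv Lx) (inL g2).
    by rewrite u1g2 u2g2 mulr0 subr0 mulr1; apply/eqP.
  have : u1 g1 = 0.
    apply: closure_zero (inL g1) => // y Ly; apply/eqP; apply: contrapT => uy.
    by apply: nx; exists y; split => //; apply/negP.
  by rewrite u1g1 => /eqP; rewrite oner_eq0.
move/existsNP => [j nj]; have := lam_neq1 j; rewrite -subr_eq0 => /eqP; apply.
rewrite -hfun_ee; apply: closure_zero (functional_hfun j) _ (inL _) => y Ly.
by apply/eqP; apply: contrapT => /negP hy; apply: nj; exact: Lset_dvd Ly hy.
Qed.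

(** * Generic vectors: their return spaces, recurrence and density *)

Lemma iter_wild_linear k : linear (iter k wild).
Proof.
elim: k => [//|k IH] a x y; rewrite !iterS.
have -> : iter k wild (a *: x + y) = a *: iter k wild x + iter k wild y by exact: IH.
exact: wild_bounded.1.
Qed.

Lemma Lset_lin w a x y : Lset wild w x -> Lset wild w y -> Lset wild w (a *: x + y).
Proof.
move=> Lx Ly; rewrite /Lset /=; under eq_fun do rewrite iter_wild_linear.
by apply: cvgD Ly; exact: cvgZr.
Qed.

Lemma Lset0 w : Lset wild w 0.
Proof.
apply/Lset_tends => d d0; exists 0%N => n _.
have := iter_wild_linear (w n) (-1) 0 0; rewrite scaler0 addr0 scaleN1r addNr => ->.
by rewrite subrr rnorm0.
Qed.

Lemma Lset_e w j : eventually_divisible w -> Lset wild w (e j).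
Proof.
move=> wdiv; apply/Lset_tends => d d0; have [M hM] := wdiv j; exists M => n Mn.
rewrite (idplus_iter_id e1 functional_hfun hfun_bounded hfun_e hfun_ee) ?subrr ?rnorm0 // => i.
have [<-|ij] := eqVneq j i; first by rewrite geosum_eq0 ?mul0r // hM.
by rewrite hfun_e ?mulr0.
Qed.

(** The conditions serve in turn to make the determinant against [q] nonzero, to force divisibility
    of return times, and to give recurrence along the [2 ^ expo n]. *)
Definition generic q :=
  [/\ u1 q != 0, forall j, hfun j q != 0 &
   forall N, exists n, (N <= n)%N /\ 2 ^+ b n * modc (wfun n q) < 2^-1 ^+ N].

(** One inclusion is proportionality. For the other, subtracting a multiple of [q] lands in the
    common kernel of [u1] and [u2], where combinations of the returning vectors [e j] are dense. *)
Lemma Lset_generic w q : generic q -> incr_pos w -> Lset wild w q ->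
  closure (Lset wild w) = [set x | u1 q * u2 x - u2 q * u1 x = 0].
Proof.
move=> [uq hq _] wpos Lq.
have wdiv : eventually_divisible w by move=> j; exact: Lset_dvd Lq (hq j).
apply/seteqP; split => [x|x /= qx].
  apply: (closure_zero (functional_minor q)) => y.
  exact: Lset_proportional wpos wdiv Lq.
apply/closure_rnormP => d d0; pose c := u1 x / u1 q; pose y := x - c *: q.
have y1 : u1 y = 0 by rewrite (functionalB fu1) (functionalZ fu1) divfK ?subrr.
have y2 : u2 y = 0.
  rewrite (functionalB fu2) (functionalZ fu2); apply: (mulfI uq).
  by rewrite mulr0 -[RHS]qx mulrBr /c; congr (_ - _); field.
have [a [n hy]] := edense d0 y1 y2.
exists (c *: q + \sum_(i < n) a i *: e i); split.
  apply: Lset_lin => //; elim: n {hy} => [|n IH]; first by rewrite big_ord0; exact: Lset0.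
  by rewrite big_ord_recr /= addrC; apply: Lset_lin => //; exact: Lset_e.
have -> : c *: q + \sum_(i < n) a i *: e i - x = \sum_(i < n) a i *: e i - y.
  by rewrite opprB addrAC addrC.
exact: hy.
Qed.

Lemma generic_recurrent q : generic q -> recurrent_vector wild q.
Proof.
move=> [_ _ wq]; apply: recurrent_vectorP => d N d0.
have [M hM] := half_small (1 + (2 * C + W) * rnorm q) d0.
have K0 : 0 <= (2 * C + W) * rnorm q.
  by rewrite mulr_ge0 ?rnorm_ge0 // addr_ge0 ?mulr_ge0 // ltW.
have [n [Mn hn]] := wq (maxn M N).
exists (2 ^ expo n)%N; split.
  apply: (@leq_ltn_trans n); first exact: leq_trans (leq_maxr M N) Mn.
  by apply: leq_ltn_trans (expo_ge n) _; exact: ltn_expl.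
apply: (le_lt_trans (wild_near n q)).
apply: le_lt_trans (hM (maxn M N) (leq_maxl _ _)).
rewrite [(1 + _) * _]mulrDl mul1r lerD ?(ltW hn) // ler_wpM2l //.
by rewrite !exprVn lef_pV2 ?posrE // ler_eXn2l ?ltr1n.
Qed.

(** The inequality holds on a ball around each zero of [wfun n], and zeros with [n >= N] are
    dense. *)
Lemma dense_interior_wfun N : dense_interior (fun q =>
  exists n, (N <= n)%N /\ 2 ^+ b n * modc (wfun n q) < 2^-1 ^+ N).
Proof.
move=> x d d0; have [n [y [Nn yx wy]]] := wdense x N d0.
exists y, (2^-1 ^+ N / (2 ^+ b n * W)); split => //.
  by rewrite divr_gt0 // mulr_gt0.
move=> z; rewrite ltr_pdivlMr ?mulr_gt0 // => zy; exists n; split => //.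
apply: le_lt_trans zy; rewrite mulrCA ler_pM2l // mulrC.
have -> : wfun n z = wfun n (z - y) by rewrite (functionalB (functional_wfun n)) wy subr0.
exact: wfun_le.
Qed.

Lemma generic_dense x (d : R) : 0 < d -> exists q, rnorm (q - x) < d /\ generic q.
Proof.
move=> d0; pose F i q := u1 q != 0 /\ hfun i q != 0 /\
  exists n, (i <= n)%N /\ 2 ^+ b n * modc (wfun n q) < 2^-1 ^+ i.
have dF i : dense_interior (F i).
  apply: dense_interior_and.
    by apply: (dense_interior_neq0 (v := g1) fu1); rewrite u1g1 oner_eq0.
  apply: dense_interior_and; last exact: dense_interior_wfun.
  apply: (dense_interior_neq0 (v := e i) (functional_hfun i)).
  by rewrite hfun_ee subr_eq0 lam_neq1.
have [q [qx Fq]] := rnorm_baire dF x d0.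
exists q; split => //; split => [|j|N]; first by case: (Fq 0%N).
  by case: (Fq j) => _ [].
by case: (Fq N) => _ [].
Qed.

Lemma closure_generic (A : set X) : (forall q, generic q -> A q) -> closure A = setT.
Proof.
move=> gA; apply/seteqP; split => // x _; apply/closure_rnormP => d d0.
by have [q [qx /gA Aq]] := generic_dense x d0; exists q.
Qed.

Lemma Lset_subsequence w mu x : subsequence mu w -> Lset wild w x -> Lset wild mu x.
Proof.
move=> [phi [hphi ->]] /Lset_tends wx; apply/Lset_tends => d d0.
have [M hM] := wx _ d0; exists M => n Mn; apply: hM; apply: (leq_trans Mn).
by elim: n {Mn} => // n IH; apply: (leq_ltn_trans IH); exact: hphi.
Qed.

Lemma wild_properties :
  bounded_operator wild /\ recurrent wild /\ Hr wild = set0 /\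
  closure [set q | St wild q /\ forall w, Cset wild w -> Lset wild w q ->
    codim1 (closure (Lset wild w))] = setT.
Proof.
split; first exact: wild_bounded.
split; first by apply: closure_generic; exact: generic_recurrent.
split.
  apply/seteqP; split => // x [[w [wpos wx]] hx].
  (* A nonzero vector puts its own return sequence into [Cset]; the zero vector borrows one from a
     generic vector, as 0 returns along every sequence. *)
  have [x0|x0] := eqVneq x 0; last first.
    apply: (wild_Lset_not_dense wpos); apply: hx => //.
    by split => //; exists x; split => //; exact/eqP.
  have [q [_ gq]] := generic_dense 0 (@ltr01 R).
  have [v [vpos vq]] := generic_recurrent gq.
  apply: (wild_Lset_not_dense vpos); apply: hx; last by rewrite x0; exact: Lset0.
  split => //; exists q; split => // q0; case: gq => /eqP + _ _; apply.
  by rewrite q0 (functional0 fu1).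
apply: closure_generic => q gq; split; [split|].
- exact: generic_recurrent.
- move=> w Cw Lq; split => // mu smu.
  have mpos : incr_pos mu.
    have [phi [hphi ->]] := smu; have [[wi w0] _] := Cw.
    by split => [m n /hphi/wi|n]; last exact: w0.
  (* Both closures are the hyperplane determined by [q] alone. *)
  rewrite (Lset_generic gq Cw.1 Lq) (Lset_generic gq mpos) //.
  exact: Lset_subsequence Lq.
- move=> w [wpos _] Lq; rewrite (Lset_generic gq wpos Lq).
  have uq : u1 q != 0 by case: gq.
  (* The determinant of [q] against [g2] is [u1 q != 0], so [g2] spans a complement. *)
  exists g2 => /=; rewrite u1g2 u2g2 mulr0 subr0 mulr1; split; first exact/eqP.
  move=> x; pose c := (u1 q * u2 x - u2 q * u1 x) / u1 q.
  exists (x - c *: g2), c; rewrite subrK; split => //=.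
  rewrite !(functionalB fu1, functionalB fu2, functionalZ fu1, functionalZ fu2).
  by rewrite u1g2 u2g2 /c; field.
Qed.

End WildOperator.

(** * Choice of the data and conclusion *)

Theorem theorem4p12 (R : realType) (X : completeNormedModType R[i]) :
  @separable_space _ X -> @infinite_dimensional _ X ->
  exists T : X -> X,
    bounded_operator T /\ recurrent T /\ Hr T = set0 /\
    closure [set q | St T q /\
       forall w, Cset T w -> Lset T w q -> codim1 (closure (Lset T w))] = setT.
Proof.
move=> sepX dimX; have [d [E [F [dd E1 fF FE dE]]]] := biorthogonal_system sepX dimX.
(* The first two pairs of the system become [g1], [u1] and [g2], [u2]; the rest, shifted by 2,
   become [e j] and [f j]. *)
have [b hb] : exists b : nat -> nat, forall j x, modc (F j.+2 x) <= 2 ^+ b j * rnorm x.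
  suff /choice[b hb] : forall j, exists n : nat, forall x,
    modc (F j.+2 x) <= 2 ^+ n * rnorm x by exists b.
  move=> j; have [K [_ hK]] := functional_bound (fF j.+2).
  have [n hn] := half_small K (@ltr01 R); exists n => x; apply: (le_trans (hK x)).
  rewrite ler_wpM2r ?rnorm_ge0 // ltW //; have := hn n (leqnn n).
  by rewrite exprVn ltr_pdivrMr ?exprn_gt0 // mul1r.
have [C [C0 hC]] := @unity_root_near1 R.
have [lam hlam] := choice (fun j => hC (expo (b := b) j.+1)).
have [K0 [K00 hK0]] := functional_bound (fF 0%N).
have [K1 [K10 hK1]] := functional_bound (fF 1%N).
have F00 : F 0%N (E 0%N) = 1 by rewrite FE.
have F01 : F 0%N (E 1%N) = 0 by rewrite FE.
have F10 : F 1%N (E 0%N) = 0 by rewrite FE.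
have F11 : F 1%N (E 1%N) = 1 by rewrite FE.
(* [z n] will be a zero of [wfun n]. Through [logn 2], each [d i] is considered at all odd multiples
   of [2 ^ i], so infinitely often; the fallback [E 0] keeps [S n] positive. *)
pose z n := if F 0%N (d (logn 2 n)) != 0 then d (logn 2 n) else E 0%N.
pose S n := modc (F 0%N (z n)) + modc (F 1%N (z n)).
have S0 n : 0 < S n.
  rewrite ltr_pwDl ?modc_ge0 // lt0r modc_ge0 modc_eq0 andbT /z.
  by case: ifP => //; rewrite F00 oner_eq0.
pose al n := F 0%N (z n) / (S n)%:C%C; pose be n := F 1%N (z n) / (S n)%:C%C.
have abe n : modc (al n) + modc (be n) = 1.
  rewrite !modcM !Normc.normcV !modcR gtr0_norm // -mulrDl mulfV // gt_eqF //; exact: S0.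
have W0 : 0 < K0 + K1 by rewrite addr_gt0.
exists (wild (e := fun j => E j.+2) (f := fun j => F j.+2) (u1 := F 0%N) (u2 := F 1%N)
  (b := b) (al := al) (be := be) (lam := lam)).
apply: (@wild_properties _ _ _ _ _ _ (E 0%N) (E 1%N) b al be lam C (K0 + K1)) => //.
- by move=> i j /=; rewrite FE !eqSS.
- by move=> x; rewrite mulrDl lerD.
- by move=> j; case: (hlam j).
- by move=> j k; case: (hlam j) => _ + _; apply.
- by move=> j; case: (hlam j).
(* Some [d i] near [x] lies in a ball where [F 0] has no zero, so the fallback does not replace it;
   the index [2 ^ i * (2 N + 1)] is at least [N]. *)
- move=> x r N r0; have r2 : 0 < r / 2 by rewrite divr_gt0.
  have F0E : F 0%N (E 0%N) != 0 by rewrite F00 oner_eq0.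
  have [y [s [s0 yx hy]]] := dense_interior_neq0 (fF 0%N) F0E x r2.
  have m0 : 0 < Num.min s (r / 2) by rewrite lt_min s0.
  have [i +] := dd y _ m0; rewrite lt_min => /andP[dys dyr].
  have lgi : logn 2 (2 ^ i * N.*2.+1) = i.
    by rewrite lognM ?expn_gt0 // pfactorK // logn_coprime ?addn0 // coprime2n /= odd_double.
  exists (2 ^ i * N.*2.+1)%N, (d i); split.
  + apply: leq_trans (leq_pmull _ _); last by rewrite expn_gt0.
    by rewrite -addnn; lia.
  + by have := rdistD y (d i) x; lra.
  + have zi : z (2 ^ i * N.*2.+1)%N = d i by rewrite /z lgi hy.
    by rewrite /wfun /al /be zi; ring.
- move=> x r r0 x0 x1; have K2 : 0 < 1 + (K0 + K1) by rewrite addr_gt0.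
  have [i hi] := dd x _ (divr_gt0 r0 K2).
  exists (fun j => F j.+2 (d i)), i.+1.
  (* The sum is the expansion of [d i] over [i + 3] indices without its first two terms. Their
     coefficients are values at [d i - x], since [F 0] and [F 1] vanish at [x], and so are small. *)
  have -> : \sum_(j < i.+1) F j.+2 (d i) *: E j.+2 - x = (d i - x) -
      (F 0%N (d i - x) *: E 0%N + F 1%N (d i - x) *: E 1%N).
    have := dE i i.+3 (leqW (leqnSn _)); rewrite 2!big_ord_recl /= => h.
    rewrite !(functionalB (fF _)) x0 x1 !subr0 addrAC; congr (_ - _).
    apply: (addIr (F 0%N (d i) *: E 0%N + F 1%N (d i) *: E 1%N)); rewrite subrK addrC -addrA.
    exact: esym h.
  apply: (le_lt_trans (rnormB _ _)); move: hi; rewrite ltr_pdivlMr // mulrC.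
  apply: le_lt_trans; rewrite mulrDl mul1r lerD2l.
  rewrite (le_trans (rnormD _ _)) // !rnormZ !E1 !mulr1 mulrDl lerD //.
Qed.
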